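(* Let $b>0$ and let $(Y_t)_{t=1}^\infty$ be a martingale with respect to a filtration $(\mathcal F_t)$, taking values in the symmetric real $d\times d$ matrices, with $Y_0=0$ and $\gamma_{\max}(Y_t-Y_{t-1})\le b$ a.s. for all $t$. Let $V_t=\gamma_{\max}\left(\sum_{i=1}^t\mathbb{E}_{i-1}(Y_i-Y_{i-1})^2\right)$ and $S_t=\gamma_{\max}(Y_t)$. Then for any $\eta>1$, $s>1$, $m>0$, $\alpha\in(0,1)$, $$\mathbb{P}\left(\exists t\ge 1:\ S_t\ge k_1(\eta)\sqrt{\max(V_t,m)\,\ell_{\eta,s}(\max(V_t,m))}+\frac{b\,k_2(\eta)}{3}\,\ell_{\eta,s}(\max(V_t,m))\right)\le\alpha,$$ where $$\ell_{\eta,s}(v)=s\log\log\left(\frac{\eta v}{m}\right)+\log\frac{d\,\zeta(s)}{\alpha\log^s\eta},\qquad k_1(\eta)=\frac{\eta^{1/4}+\eta^{-1/4}}{\sqrt2},\qquad k_2(\eta)=\frac{\sqrt\eta+1}{2}.$$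
   Context: $\gamma_{\max}(\cdot)$ is the maximum eigenvalue of a symmetric matrix, $\mathbb{E}_t$ denotes conditional expectation given $\mathcal F_t$, $\zeta$ is the Riemann zeta function, and $\log^s\eta=(\log\eta)^s$. *)

(* Defs.v *)
From HB Require Import structures.
From mathcomp Require Import all_boot all_order all_algebra.
From mathcomp Require Import all_classical all_reals all_analysis.
Import Order.TTheory GRing.Theory Num.Theory.
Import numFieldNormedType.Exports.

Set Implicit Arguments.
Unset Strict Implicit.
Unset Printing Implicit Defensive.

Local Open Scope classical_set_scope.
Local Open Scope ring_scope.

Definition symmetric_mx (R : realType) (d : nat) (A : 'M[R]_d) : Prop :=
  A^T = A.

(* For a symmetric real A of size d > 0 the set of eigenvalues is finite and
   nonempty, so that the supremum is the maximum eigenvalue. *)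
Definition gamma_max (R : realType) (d : nat) (A : 'M[R]_d) : R :=
  sup [set a | eigenvalue A a].

Definition filtration (disp : measure_display) (T : measurableType disp)
    (F : nat -> set (set T)) : Prop :=
  [/\ forall t, sigma_algebra setT (F t),
      forall t, F t `<=` measurable
    & forall t, F t `<=` F t.+1].

Definition measurable_wrt (R : realType) (T : Type) (G : set (set T))
    (f : T -> R) : Prop :=
  forall B : set R, measurable B -> G (f @^-1` B).

(* C is a version of the conditional expectation of X given the sub-sigma-algebra
   G.  For integrable X this is the usual definition (take A n = setT); in
   general it only requires X to be integrable on the pieces of a countable
   G-measurable cover, i.e. E(|X| | G) < oo a.s., so that C is finite. *)
Definition is_condexp (R : realType) (disp : measure_display)
    (T : measurableType disp) (P : probability T R) (G : set (set T))
    (X C : T -> R) : Prop :=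
  [/\ measurable_wrt G C,
      exists A : nat -> set T,
        [/\ forall n, G (A n), \bigcup_n A n = setT
          & forall n, P.-integrable (A n) (EFin \o X)]
    & forall A, G A -> P.-integrable A (EFin \o X) ->
        (\int[P]_(w in A) (C w)%:E = \int[P]_(w in A) (X w)%:E)%E].

Definition is_condexp_mx (R : realType) (disp : measure_display)
    (T : measurableType disp) (P : probability T R) (G : set (set T))
    (d : nat) (X C : T -> 'M[R]_d) : Prop :=
  forall i j, is_condexp P G (fun w => X w i j) (fun w => C w i j).

Definition martingale_mx (R : realType) (disp : measure_display)
    (T : measurableType disp) (P : probability T R) (F : nat -> set (set T))
    (d : nat) (Y : nat -> T -> 'M[R]_d) : Prop :=
  [/\ forall t i j, measurable_wrt (F t) (fun w => Y t w i j),
      forall t i j, P.-integrable setT (fun w => (Y t w i j)%:E)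
    & forall t, is_condexp_mx P (F t) (Y t.+1) (Y t)].

Definition zeta (R : realType) (s : R) : R := limn (series (riemannR s)).

Definition ell (R : realType) (d : nat) (m alpha eta s v : R) : R :=
  s * ln (ln (eta * v / m)) + ln (d%:R * zeta s / (alpha * (ln eta) `^ s)).

Definition k1 (R : realType) (eta : R) : R :=
  (eta `^ (4^-1) + eta `^ (- 4^-1)) / Num.sqrt 2.

Definition k2 (R : realType) (eta : R) : R := (Num.sqrt eta + 1) / 2.

(* Main.v *)
(* The trace exponential [L t = tr (exp (l Y_t - psi W_t))], where [W_t] is the
   predictable quadratic variation and [psi = l^2 / (2 (1 - l b / 3))], is a
   supermartingale, and it dominates [exp (l S_t - psi V_t)].  Ville's inequality
   therefore bounds the probability that [S_t] ever crosses a line in [V_t].  One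
   line is used for each epoch [m eta^k <= max (V_t, m) <= m eta^(k+1)], with
   slope optimal at the geometric midpoint of the epoch and with error
   [alpha / (zeta s (k+1)^s)].

   The supermartingale property rests on Lieb's concavity theorem, used as a
   tangent inequality: for symmetric [H] and [C] there is a positive semidefinite
   [G] with [tr (exp (H - C + log A)) <= tr (G A)] for all [A > 0] and
   [tr (G exp C) = tr (exp H)].  Conditional expectations then only meet linear
   functionals of [X] and [X^2].  The tangent inequality is the tangent of the
   jointly convex relative entropy, which is an integral over [s > 0] of quadratic
   forms [<Z, (T + s A)^-1 Z>].  Everything is computed in eigenbases, so that no
   matrix function other than [tr (exp A)] is needed, and integrals in [s] are
   replaced by antiderivatives together with monotonicity. *)

From HB Require Import structures.
From mathcomp Require Import all_boot all_order all_algebra.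
From mathcomp Require Import all_classical all_reals all_analysis.
From mathcomp Require Import measurable_realfun.
From mathcomp Require Import ring lra.
Require Import Defs.
Import Order.TTheory GRing.Theory Num.Theory.
Import numFieldNormedType.Exports.

Set Implicit Arguments.
Unset Strict Implicit.
Unset Printing Implicit Defensive.

Local Open Scope classical_set_scope.
Local Open Scope ring_scope.

(** * Calculus *)

Lemma is_derive_bigsum (R : realType) (I : Type) (r : seq I) (f : I -> R -> R)
    (f' : I -> R) (x : R) :
  (forall i, is_derive x 1 (f i) (f' i)) ->
  is_derive x 1 (fun y => \sum_(i <- r) f i y) (\sum_(i <- r) f' i).
Proof.
move=> fD; elim: r => [|i r IH].
  rewrite big_nil; under eq_fun do rewrite big_nil.
  exact: is_derive_cst.
rewrite big_cons; under eq_fun do rewrite big_cons.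
exact: (@is_deriveD _ _ _ (f i) (fun y => \sum_(j <- r) f j y)).
Qed.

Lemma is_derive_mulc (R : realType) (c : R) (f : R -> R) (f' x : R) :
  is_derive x 1 f f' -> is_derive x 1 (fun y => c * f y) (c * f').
Proof. by move=> fD; exact: (@is_deriveZ _ _ _ f c). Qed.

Lemma is_derive_dilate (R : realType) (f : R -> R) (f' b x : R) :
  is_derive (x * b) 1 f f' ->
  is_derive x 1 (fun y => f (y * b)) (b * f').
Proof.
move=> fD; rewrite mulrC.
apply: (@is_derive1_comp _ f (fun y => y * b)).
have := @is_derive_mulc R b id 1 x (is_derive_id _ _).
by rewrite mulr1; under eq_fun do rewrite mulrC.
Qed.

Lemma is_derive_affine (R : realType) (t b x : R) :
  is_derive x 1 (fun y => t + y * b) b.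
Proof.
have D := @is_deriveD _ _ _ (cst t) (fun y => b * y) x 1 0 (b * 1)
  (is_derive_cst _ _ _) (is_derive_mulc b (is_derive_id x (1 : R))).
move: D; rewrite add0r mulr1 (_ : cst t + _ = (fun y => t + y * b)) //.
by apply/funext => y; rewrite !fctE mulrC.
Qed.

Lemma is_derive_ln_affine (R : realType) (t b x : R) : 0 < t + x * b ->
  is_derive x 1 (fun y => ln (t + y * b)) (b / (t + x * b)).
Proof.
move=> h; rewrite mulrC.
exact: (@is_derive1_comp _ (@ln R) (fun y => t + y * b) x _ _
  (is_derive1_ln h) (is_derive_affine t b x)).
Qed.

Lemma is_derive_inv_affine (R : realType) (t b x : R) : 0 < t + x * b ->
  is_derive x 1 (fun y => (t + y * b)^-1) (- b / (t + x * b) ^+ 2).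
Proof.
move=> h.
have := @is_deriveV R (fun y => t + y * b) x b 1 (lt0r_neq0 h)
  (is_derive_affine t b x).
by rewrite /GRing.scale /= => D; apply: (is_derive_eq D); rewrite !mulNr mulrC.
Qed.

(** Stands in for integration over [[0, N]]: an inequality between integrands becomes one between
    antiderivatives that vanish at [0]. *)
Lemma ge0_derive_ndecr (R : realType) (f f' : R -> R) (N : R) :
  (forall x : R, 0 <= x -> is_derive x 1 f (f' x)) ->
  (forall x : R, 0 <= x -> 0 <= f' x) -> 0 <= N -> f 0 <= f N.
Proof.
move=> fD f0 N0.
apply: (@ger0_derive1_ndecry R f 0) => //.
- by move=> x; rewrite in_itv/= andbT => /ltW x0; case: (fD _ x0).
- move=> x; rewrite in_itv/= andbT => /ltW x0.
  by rewrite derive1E; case: (fD _ x0) => _ ->; exact: f0.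
- apply: derivable_within_continuous => x; rewrite in_itv/= andbT => x0.
  by case: (fD _ x0).
Qed.

(* [Ekl t u y] is the integral of [z / ((t + z) (u + z))] over [0 <= z <= y] *)
Definition Ekl (R : realType) (t u y : R) : R :=
  if t == u then ln (t + y) - ln t + t / (t + y) - 1
  else (t * (ln (t + y) - ln t) - u * (ln (u + y) - ln u)) / (t - u).

(** The limit of [Ekl t u y - ln y] as [y] grows. It is minus the divided difference of [z ln z] at
    [t] and [u], hence minus the derivative [ln t + 1] when [t = u]. *)
Definition Ekl_inf (R : realType) (t u : R) : R :=
  if t == u then - ln t - 1 else (u * ln u - t * ln t) / (t - u).

Lemma Ekl0 (R : realType) (t u : R) : 0 < t -> Ekl t u 0 = 0.
Proof.
move=> t0; rewrite /Ekl; case: eqP => _; rewrite !addr0 !subrr ?mulr0.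
  by rewrite divff ?gt_eqF// add0r subrr.
by rewrite subrr mul0r.
Qed.

Lemma is_derive_Ekl (R : realType) (t u y : R) : 0 < t -> 0 < u -> 0 <= y ->
  is_derive y 1 (Ekl t u) (y / ((t + y) * (u + y))).
Proof.
move=> t0 u0 y0.
have H (a : R) : 0 < a -> is_derive y 1 (fun z => ln (a + z)) (a + y)^-1.
  move=> a0; have := @is_derive_ln_affine R a 1 y.
  rewrite mulr1 mul1r; under eq_fun do rewrite mulr1.
  by apply; lra.
rewrite /Ekl; case: eqP => [<-|/eqP tu].
  have D1 := H _ t0.
  have : is_derive y 1 (fun z => (t + z)^-1) (- 1 / (t + y) ^+ 2).
    have := @is_derive_inv_affine R t 1 y.
    rewrite mulr1; under eq_fun do rewrite mulr1.
    by apply; lra.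
  move=> /(is_derive_mulc t) D2.
  have D := is_deriveB (is_deriveD (is_deriveB D1
     (is_derive_cst (ln t) y 1)) D2) (is_derive_cst (1 : R) y 1).
  apply: (@is_derive_eq _ _ _ _ _ _ _ _ D).
  by field; rewrite gt_eqF//; lra.
have D := is_derive_mulc (t - u)^-1 (is_deriveB
  (is_derive_mulc t (is_deriveB (H _ t0) (is_derive_cst (ln t) y 1)))
  (is_derive_mulc u (is_deriveB (H _ u0) (is_derive_cst (ln u) y 1)))).
rewrite [X in is_derive _ _ X](_ : _ = (fun z => (t - u)^-1 *
  (t * (ln (t + z) - ln t) - u * (ln (u + z) - ln u)))); last first.
  by apply/funext => z; rewrite mulrC.
apply: (@is_derive_eq _ _ _ _ _ _ _ _ D).
by field; rewrite subr_eq0 tu !gt_eqF//; lra.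
Qed.

Lemma ln_shift_bounds (R : realType) (t y : R) : 0 < t -> 0 < y ->
  0 <= ln (t + y) - ln y <= t / y.
Proof.
move=> t0 y0; apply/andP; split.
  by rewrite subr_ge0 ler_ln ?posrE; lra.
rewrite -ln_div ?posrE; [|lra..].
have -> : (t + y) / y = 1 + t / y by field; rewrite gt_eqF.
by apply: le_ln1Dx; rewrite (@lt_trans _ _ 0)// ?ltrN10// divr_gt0.
Qed.

(** Every logarithm in [Ekl] differs from [ln y] by at most [t / y] or [u / y]. The explicit rate
    lets a finite cut-off replace the limit in [lieb_tangent]. *)
Lemma Ekl_asymp (R : realType) (t u : R) : 0 < t -> 0 < u ->
  exists2 c, 0 <= c &
    forall y, 0 < y -> `|Ekl t u y - ln y - Ekl_inf t u| <= c / y.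
Proof.
move=> t0 u0; rewrite /Ekl /Ekl_inf; case: eqP => [_|/eqP tu].
  exists (t + t); first lra.
  move=> y y0; have /andP[h1 h2] := ln_shift_bounds t0 y0.
  have h3 : 0 <= t / (t + y) by rewrite divr_ge0; lra.
  have h4 : t / (t + y) <= t / y by rewrite ler_pM2l// lef_pV2 ?posrE; lra.
  rewrite mulrDl (_ : _ - _ = ln (t + y) - ln y + t / (t + y)); last by ring.
  by rewrite ger0_norm; lra.
exists ((t ^+ 2 + u ^+ 2) / `|t - u|).
  by rewrite divr_ge0// addr_ge0// sqr_ge0.
move=> y y0.
rewrite (_ : _ - _ = (t * (ln (t + y) - ln y) - u * (ln (u + y) - ln y))
   / (t - u)); last by field; rewrite subr_eq0.
rewrite normrM normfV mulrAC ler_pM2r ?invr_gt0 ?normr_gt0 ?subr_eq0//.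
have /andP[h1 h2] := ln_shift_bounds t0 y0.
have /andP[h3 h4] := ln_shift_bounds u0 y0.
rewrite (le_trans (ler_normB _ _))// !normrM (gtr0_norm t0) (gtr0_norm u0) (ger0_norm h1) (ger0_norm h3).
rewrite mulrDl !expr2 -!mulrA lerD// ler_pM2l//.
Qed.

(* [Jmn t b c s] is the integral of [t^2 / ((t + z b) (t + z c))] over
   [0 <= z <= s] *)
Definition Jmn (R : realType) (t b c s : R) : R :=
  if b == c then t / b - t ^+ 2 / b / (t + s * b)
  else t / (b - c) * (ln (t + s * b) - ln (t + s * c)).

Lemma Jmn0 (R : realType) (t b c : R) : 0 < t -> 0 < b -> Jmn t b c 0 = 0.
Proof.
move=> t0 b0; rewrite /Jmn; case: eqP => _; rewrite !mul0r !addr0.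
  by field; rewrite !gt_eqF.
by rewrite subrr mulr0.
Qed.

(** The integral of [t^2 / (t + z b)^2] over the whole half-line is [t / b]. *)
Lemma Jmn_diag (R : realType) (t b s : R) : 0 < t -> 0 < b -> 0 <= s ->
  b * Jmn t b b s <= t.
Proof.
move=> t0 b0 s0; rewrite /Jmn eqxx.
have -> : b * (t / b - t ^+ 2 / b / (t + s * b)) = t - t ^+ 2 / (t + s * b).
  by field; rewrite !gt_eqF//; nra.
by rewrite gerBl divr_ge0 ?sqr_ge0//; nra.
Qed.

Lemma is_derive_Jmn (R : realType) (t b c s : R) :
  0 < t -> 0 < b -> 0 < c -> 0 <= s ->
  is_derive s 1 (Jmn t b c) (t ^+ 2 / ((t + s * b) * (t + s * c))).
Proof.
move=> t0 b0 c0 s0.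
have tb : 0 < t + s * b by nra.
have tc : 0 < t + s * c by nra.
rewrite /Jmn; case: eqP => [<-|/eqP bc].
  have D := is_deriveB (is_derive_cst (t / b) s 1)
    (is_derive_mulc (t ^+ 2 / b) (is_derive_inv_affine tb)).
  apply: (@is_derive_eq _ _ _ _ _ _ _ _ D).
  by field; rewrite !gt_eqF.
have D := is_derive_mulc (t / (b - c)) (is_deriveB
  (is_derive_ln_affine tb) (is_derive_ln_affine tc)).
apply: (@is_derive_eq _ _ _ _ _ _ _ _ D).
by field; rewrite subr_eq0 bc !gt_eqF.
Qed.

(** * Lieb's inequality in eigenbases *)

Lemma mulmx_conj_diag (R : comPzRingType) n (A B : 'M[R]_n) i :
  (A *m B *m A^T) i i = \sum_k \sum_l A i k * A i l * B k l.
Proof.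
rewrite mxE exchange_big; apply: eq_bigr => l _ /=.
rewrite !mxE mulr_suml; apply: eq_bigr => k _.
by ring.
Qed.

(** The factor [t a / (t + s a)] is the parallel sum of [a] and [t / s]. For a fixed value of
    [p + s q] the right-hand side is least when [a p = t q], and the gap is a multiple of
    [(t q - a p)^2]. *)
Lemma parallel_sum_le (R : realFieldType) (t a s p q : R) :
  0 < t -> 0 < a -> 0 <= s ->
  (p + s * q) ^+ 2 * (t * (a / (t + s * a))) <= t * s * q ^+ 2 + a * p ^+ 2.
Proof.
move=> t0 a0 s0; have d0 : 0 < t + s * a by nra.
rewrite mulrA mulrA ler_pdivrMr// -subr_ge0.
rewrite (_ : _ - _ = s * (t * q - a * p) ^+ 2); last by ring.
by rewrite mulr_ge0// sqr_ge0.
Qed.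

Section lieb.
Variables (R : realType) (n : nat) (al om be : 'M[R]_n).
Variables (t th a b : 'I_n -> R).
Hypothesis al1 : al *m al^T = 1%:M.
Hypothesis be1 : be *m be^T = 1%:M.
Hypotheses (t0 : forall i, 0 < t i) (th0 : forall i, 0 < th i).
Hypotheses (a0 : forall i, 0 < a i) (b0 : forall i, 0 < b i).

(** In the application [th], [b], [a] and [t] are the exponentials of the eigenvalues of [H], [C],
    [L] and [M = H - C + L]. The matrices [al], [om], [be] change eigenbasis from [M] to [H], [H] to
    [C], [C] to [L], so [w] goes from [M] to [L]. *)
Let w := al *m om *m be.

(* The left-hand side is the infimum, over decompositions [V + s W = om], of a
   form linear in [(t, a)]; the right-hand side is the value of that form at the
   decomposition optimal for [(th, b)].  Integrated over [s], the left-hand side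
   becomes minus the relative entropy, up to affine terms. *)
Lemma lieb_pointwise (s : R) : 0 <= s ->
  \sum_i \sum_j w i j ^+ 2 * (t i * (a j / (t i + s * a j))) <=
  \sum_i t i * (\sum_k \sum_l al i k * al i l * (\sum_m om k m * om l m *
     (b m * (s * b m / ((th k + s * b m) * (th l + s * b m)))))) +
  \sum_j a j * (\sum_m \sum_p be m j * be p j * (\sum_k om k m * om k p *
     (th k ^+ 2 / ((th k + s * b m) * (th k + s * b p))))).
Proof.
move=> s0.
have d0 k m : th k + s * b m != 0.
  by rewrite gt_eqF// (@lt_le_trans _ _ (th k))// lerDl mulr_ge0// ltW.
(* Entry by entry, [V] and [W] are the optimal splitting in [parallel_sum_le] for the pair
   [(th, b)], where [b p = th q]. They serve as a trial splitting for [(t, a)]. *)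
pose V := \matrix_(k, m) (om k m * (th k / (th k + s * b m))).
pose W := \matrix_(k, m) (om k m * (b m / (th k + s * b m))).
have VW : V + s *: W = om.
  by apply/matrixP => k m; rewrite !mxE; field.
pose P := al *m V *m be; pose Q := al *m W *m be.
have PQ i j : w i j = P i j + s * Q i j.
  rewrite /w -VW mulmxDr mulmxDl -scalemxAr -scalemxAl.
  by rewrite [LHS]mxE; congr (_ + _); rewrite mxE.
have E1 i : \sum_k \sum_l al i k * al i l * (\sum_m om k m * om l m *
     (b m * (s * b m / ((th k + s * b m) * (th l + s * b m))))) =
     \sum_j s * Q i j ^+ 2.
  rewrite -mulr_sumr.
  have -> : \sum_j Q i j ^+ 2 = (al *m (W *m W^T) *m al^T) i i.
    have -> : al *m (W *m W^T) *m al^T = Q *m Q^T.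
      by rewrite /Q !trmx_mul !mulmxA -(mulmxA _ be) be1 mulmx1.
    by rewrite mxE; apply: eq_bigr => j _; rewrite [Q^T _ _]mxE expr2.
  rewrite mulmx_conj_diag mulr_sumr; apply: eq_bigr => k _.
  rewrite mulr_sumr; apply: eq_bigr => l _.
  rewrite mulrCA; congr (_ * _); rewrite mxE mulr_sumr.
  apply: eq_bigr => m _; rewrite !mxE.
  by field; rewrite !d0.
have E2 j : \sum_m \sum_p be m j * be p j * (\sum_k om k m * om k p *
     (th k ^+ 2 / ((th k + s * b m) * (th k + s * b p)))) =
     \sum_i P i j ^+ 2.
  have -> : \sum_i P i j ^+ 2 = (be^T *m (V^T *m V) *m be^T^T) j j.
    have -> : be^T *m (V^T *m V) *m be^T^T = P^T *m P.
      by rewrite trmxK /P !trmx_mul !mulmxA -(mulmxA _ al^T) (mulmx1C al1) mulmx1.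
    by rewrite mxE; apply: eq_bigr => i _; rewrite [P^T _ _]mxE expr2.
  rewrite mulmx_conj_diag; apply: eq_bigr => m _; apply: eq_bigr => p _.
  rewrite !mxE; congr (_ * _).
  by apply: eq_bigr => k _; rewrite !mxE; field; rewrite !d0.
under [X in _ <= X + _]eq_bigr do rewrite E1 mulr_sumr.
under [X in _ <= _ + X]eq_bigr do rewrite E2 mulr_sumr.
rewrite [X in _ <= _ + X]exchange_big -big_split ler_sum//= => i _.
rewrite -big_split ler_sum//= => j _.
rewrite PQ [t i * (s * _)]mulrA; exact: parallel_sum_le.
Qed.

(** The integral over [0 <= s <= N] of [V^T V], where [V] has the entries
    [om k m * th k / (th k + s * b m)] of the optimal splitting. *)
Definition lieb_gram (N : R) : 'M[R]_n :=
  \matrix_(m, p) \sum_k om k m * om k p * Jmn (th k) (b m) (b p) N.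

(** This is [lieb_pointwise] integrated over [[0, N]]: the difference of the two sides vanishes at
    [0] and has a nonnegative derivative. The substitution [z = s * b m] produces the argument
    [N * b m] of [Ekl]. *)
Lemma lieb_integrated (N : R) : 0 <= N ->
  \sum_i \sum_j w i j ^+ 2 * (t i * (ln (t i + N * a j) - ln (t i))) <=
  \sum_i t i * (\sum_k \sum_l al i k * al i l * (\sum_m om k m * om l m *
     Ekl (th k) (th l) (N * b m))) +
  \sum_j a j * (be^T *m lieb_gram N *m be^T^T) j j.
Proof.
move=> N0.
pose f s := \sum_i t i * (\sum_k \sum_l al i k * al i l *
    (\sum_m om k m * om l m * Ekl (th k) (th l) (s * b m))) +
  \sum_j a j * (\sum_m \sum_p be m j * be p j * (\sum_k om k m * om k p *
    Jmn (th k) (b m) (b p) s)) -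
  \sum_i \sum_j w i j ^+ 2 * (t i * (ln (t i + s * a j) - ln (t i))).
have f0 : f 0 = 0.
  rewrite /f !big1 ?addr0 ?subr0// => i _.
  - by rewrite big1// => j _; rewrite mul0r addr0 subrr !mulr0.
  - rewrite big1 ?mulr0// => m _; rewrite big1// => p _.
    by rewrite big1 ?mulr0// => k _; rewrite Jmn0 ?mulr0.
  - rewrite big1 ?mulr0// => k _; rewrite big1// => l _.
    by rewrite big1 ?mulr0// => m _; rewrite mul0r Ekl0 ?mulr0.
suff : f 0 <= f N.
  rewrite f0 /f subr_ge0 => /le_trans; apply; rewrite lerD2l.
  apply: ler_sum => j _; rewrite ler_pM2l// mulmx_conj_diag le_eqVlt.
  apply/orP; left; apply/eqP; apply: eq_bigr => m _; apply: eq_bigr => p _.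
  by rewrite !mxE.
apply: (@ge0_derive_ndecr _ _ (fun s =>
  \sum_i t i * (\sum_k \sum_l al i k * al i l * (\sum_m om k m * om l m *
     (b m * (s * b m / ((th k + s * b m) * (th l + s * b m)))))) +
  \sum_j a j * (\sum_m \sum_p be m j * be p j * (\sum_k om k m * om k p *
     (th k ^+ 2 / ((th k + s * b m) * (th k + s * b p))))) -
  \sum_i \sum_j w i j ^+ 2 * (t i * (a j / (t i + s * a j))))) => //.
- move=> s s0; apply: is_deriveB; first apply: is_deriveD.
  + apply: is_derive_bigsum => i; apply: is_derive_mulc.
    apply: is_derive_bigsum => k; apply: is_derive_bigsum => l.
    apply: is_derive_mulc; apply: is_derive_bigsum => m.
    apply: is_derive_mulc; apply: is_derive_dilate.
    by apply: is_derive_Ekl => //; rewrite mulr_ge0// ltW.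
  + apply: is_derive_bigsum => j; apply: is_derive_mulc.
    apply: is_derive_bigsum => m; apply: is_derive_bigsum => p.
    apply: is_derive_mulc; apply: is_derive_bigsum => k.
    by apply: is_derive_mulc; apply: is_derive_Jmn.
  + apply: is_derive_bigsum => i; apply: is_derive_bigsum => j.
    apply: is_derive_mulc; apply: is_derive_mulc.
    have tsa : 0 < t i + s * a j.
      by rewrite (@lt_le_trans _ _ (t i))// lerDl mulr_ge0// ltW.
    have := is_deriveB (is_derive_ln_affine tsa) (is_derive_cst (ln (t i)) s 1).
    by rewrite subr0.
- by move=> s s0; rewrite subr_ge0 lieb_pointwise.
Qed.

End lieb.

(** The derivative in [N] is the quadratic form of some [V^T V], which is a sum of squares. *)
Lemma lieb_gram_psd (R : realType) n (om : 'M[R]_n) (th b : 'I_n -> R) (N : R)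
  (x : 'rV[R]_n) : (forall i, 0 < th i) -> (forall i, 0 < b i) -> 0 <= N ->
  0 <= (x *m lieb_gram om th b N *m x^T) 0 0.
Proof.
move=> th0 b0 N0.
pose f s := \sum_p \sum_m (x 0 m * x 0 p) * (\sum_k om k m * om k p *
    Jmn (th k) (b m) (b p) s).
have E s : (x *m lieb_gram om th b s *m x^T) 0 0 = f s.
  rewrite mxE; apply: eq_bigr => p _; rewrite !mxE mulr_suml.
  by apply: eq_bigr => m _; rewrite !mxE; ring.
have f0 : f 0 = 0.
  rewrite /f big1// => p _; rewrite big1// => m _; rewrite big1 ?mulr0// => k _.
  by rewrite Jmn0 ?mulr0.
rewrite E -f0.
apply: (@ge0_derive_ndecr _ _ (fun s => \sum_p \sum_m (x 0 m * x 0 p) *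
  (\sum_k om k m * om k p *
     (th k ^+ 2 / ((th k + s * b m) * (th k + s * b p)))))) => //.
  move=> s s0; apply: is_derive_bigsum => p; apply: is_derive_bigsum => m.
  apply: is_derive_mulc; apply: is_derive_bigsum => k.
  by apply: is_derive_mulc; apply: is_derive_Jmn.
move=> s s0.
rewrite (_ : \sum_p _ = \sum_k (\sum_m x 0 m * om k m * (th k / (th k + s * b m))) ^+ 2).
  by apply: sumr_ge0 => k _; rewrite sqr_ge0.
under [RHS]eq_bigr do rewrite expr2 mulr_sumr.
rewrite [RHS]exchange_big; apply: eq_bigr => p _ /=.
under [RHS]eq_bigr do rewrite mulr_suml.
rewrite [RHS]exchange_big; apply: eq_bigr => m _ /=.
rewrite mulr_sumr; apply: eq_bigr => k _.
have d0 q : th k + s * b q != 0.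
  by rewrite gt_eqF// (@lt_le_trans _ _ (th k))// lerDl mulr_ge0// ltW.
by field; rewrite !d0.
Qed.

(** Each diagonal integral is at most [th k / b m], and the rows of [om] have unit length. In an
    eigenbasis of [C] this reads [tr (G exp C) <= tr (exp H)]. *)
Lemma lieb_gram_trace (R : realType) n (om : 'M[R]_n) (th b : 'I_n -> R) (N : R) :
  om *m om^T = 1%:M -> (forall i, 0 < th i) -> (forall i, 0 < b i) -> 0 <= N ->
  \sum_m b m * lieb_gram om th b N m m <= \sum_k th k.
Proof.
move=> om1 th0 b0 N0.
have -> : \sum_k th k = \sum_m \sum_k om k m ^+ 2 * th k.
  rewrite exchange_big; apply: eq_bigr => k _ /=.
  rewrite -mulr_suml; have /matrixP/(_ k k) := om1; rewrite !mxE eqxx mulr1n => om1k.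
  rewrite -[LHS]mul1r -om1k; congr (_ * _).
  by apply: eq_bigr => m _; rewrite mxE expr2.
apply: ler_sum => m _; rewrite mxE mulr_sumr; apply: ler_sum => k _.
rewrite mulrCA -expr2 ler_wpM2l ?sqr_ge0//.
exact: Jmn_diag.
Qed.

(** * Orthogonal matrices, quadratic forms and Lieb's tangent inequality *)

Definition orthogonal (R : realType) n (U : 'M[R]_n) : Prop :=
  U *m U^T = 1%:M.

Definition qform (R : realType) n (A : 'M[R]_n) (x : 'rV[R]_n) : R :=
  (x *m A *m x^T) 0 0.

(** Vectors are rows: the eigenvectors are the rows of [U], and [x *m U^T] lists the coordinates of
    [x] in the eigenbasis. *)
Definition diagonalizes (R : realType) n (U : 'M[R]_n) (a : 'rV[R]_n)
    (A : 'M[R]_n) : Prop :=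
  orthogonal U /\ A = U^T *m diag_mx a *m U.

Section orthogonal.
Variables (R : realType) (n : nat).
Implicit Types (U V A B : 'M[R]_n) (a : 'rV[R]_n).

Lemma orthogonal_trmx U : orthogonal U -> orthogonal U^T.
Proof. by rewrite /orthogonal trmxK => /mulmx1C. Qed.

Lemma orthogonal_mul U V : orthogonal U -> orthogonal V -> orthogonal (U *m V).
Proof.
rewrite /orthogonal => hU hV.
by rewrite trmx_mul !mulmxA -(mulmxA U) hV mulmx1.
Qed.

Lemma orthogonal_sqr U i : orthogonal U -> \sum_j U i j ^+ 2 = 1.
Proof.
move=> /matrixP/(_ i i); rewrite !mxE eqxx mulr1n => <-.
by apply: eq_bigr => j _; rewrite mxE expr2.
Qed.

Lemma orthogonal_le1 U i j : orthogonal U -> `|U i j| <= 1.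
Proof.
move=> /(orthogonal_sqr i); rewrite (bigD1 j)//= => h.
have : U i j ^+ 2 <= 1 by rewrite -h lerDl sumr_ge0// => k _; rewrite sqr_ge0.
by rewrite -real_normK ?num_real// -[X in _ <= X](expr1n _ 2) ler_sqr ?nnegrE.
Qed.

Lemma qform_row A U i : qform A (row i U) = (U *m A *m U^T) i i.
Proof.
rewrite /qform -row_mul mxE [RHS]mxE; apply: eq_bigr => j _.
by rewrite !mxE.
Qed.

Lemma conj_diagE U a i :
  (U *m diag_mx a *m U^T) i i = \sum_k U i k ^+ 2 * a 0 k.
Proof.
rewrite mxE; apply: eq_bigr => k _; rewrite mul_mx_diag !mxE.
by ring.
Qed.

Lemma diagonalizes_conj U a A V i : diagonalizes U a A ->
  (V *m A *m V^T) i i = \sum_k (V *m U^T) i k ^+ 2 * a 0 k.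
Proof.
by move=> [_ ->]; rewrite -conj_diagE trmx_mul trmxK !mulmxA.
Qed.

Lemma diagonalizes_diag U a A i : diagonalizes U a A ->
  (U *m A *m U^T) i i = a 0 i.
Proof.
move=> h; rewrite (diagonalizes_conj _ _ h); case: h => -> _.
rewrite (bigD1 i)//= big1 ?addr0 => [|j ji]; rewrite mxE ?eqxx ?expr1n ?mul1r//.
by rewrite eq_sym (negbTE ji) expr0n mul0r.
Qed.

End orthogonal.

(* [G] is the supergradient at [exp C] of Lieb's concave function
   [A |-> tr (exp (H - C + log A))], up to the factor [1 - eps] that truncating
   an integral over [0, +oo[ costs.  Keeping [eps] avoids taking the limit. *)
Lemma lieb_tangent (R : realType) n (H C X Y : 'M[R]_n) (h c : 'rV[R]_n)
    (eps : R) :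
  diagonalizes X h H -> diagonalizes Y c C -> 0 < eps ->
  exists G : 'M[R]_n, [/\ forall x, 0 <= qform G x,
    \sum_m expR (c 0 m) * qform G (row m Y) <= \sum_k expR (h 0 k) &
    forall L V l M U mu, diagonalizes V l L -> diagonalizes U mu M ->
      M = H - C + L ->
      (1 - eps) * \sum_i expR (mu 0 i) <=
      \sum_j expR (l 0 j) * qform G (row j V)].
Proof.
move=> dH dC eps0; have [oX HE] := dH; have [oY CE] := dC.
pose th k := expR (h 0 k); pose b k := expR (c 0 k).
have th0 k : 0 < th k by exact: expR_gt0.
have b0 k : 0 < b k by exact: expR_gt0.
pose om := X *m Y^T.
have oom : orthogonal om by exact/orthogonal_mul/orthogonal_trmx.
have [e eP] : exists e : 'I_n -> 'I_n -> R, forall k l, 0 <= e k l /\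
    forall y, 0 < y ->
      `|Ekl (th k) (th l) y - ln y - Ekl_inf (th k) (th l)| <= e k l / y.
  exists (fun k l => sval (cid2 (Ekl_asymp (th0 k) (th0 l)))) => k l.
  by case: cid2.
(* [Se / N] bounds the total error of replacing each [Ekl] by its asymptotic form. The cut-off [N]
   makes this at most [eps], and the [+ 1] keeps [N] positive. *)
pose Se := \sum_k \sum_l \sum_m e k l / b m.
have Se0 : 0 <= Se.
  apply: sumr_ge0 => k _; apply: sumr_ge0 => l _; apply: sumr_ge0 => m _.
  by rewrite divr_ge0 ?(ltW (b0 _))//; case: (eP k l).
pose N := (Se + 1) / eps.
have N0 : 0 < N by rewrite divr_gt0//; lra.
have SeN : Se / N <= eps.
  by rewrite ler_pdivrMr// /N mulrC divfK ?gt_eqF//; lra.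
(* The Gram matrix lives in the eigenbasis of [C]; conjugation by [Y] brings it back to the standard
   basis. *)
exists (Y^T *m lieb_gram om th b N *m Y).
split.
- move=> x; rewrite /qform (_ : _ *m _ = (x *m Y^T) *m lieb_gram om th b N *m
    (x *m Y^T)^T); first exact/lieb_gram_psd/ltW.
  by rewrite trmx_mul trmxK !mulmxA.
- apply: le_trans (lieb_gram_trace oom th0 b0 (ltW N0)).
  apply: ler_sum => m _; rewrite qform_row !mulmxA oY mul1mx.
  by rewrite -mulmxA oY mulmx1.
move=> L V l M U mu dL dM ME; have [oV LE] := dL; have [oU _] := dM.
pose al := U *m X^T; pose be := Y *m V^T.
have oal : orthogonal al by exact/orthogonal_mul/orthogonal_trmx.
have obe : orthogonal be by exact/orthogonal_mul/orthogonal_trmx.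
pose t i := expR (mu 0 i); pose a i := expR (l 0 i).
have t0 k : 0 < t k by exact: expR_gt0.
have a0 k : 0 < a k by exact: expR_gt0.
have alomE : al *m om = U *m Y^T.
  by rewrite /al /om !mulmxA -(mulmxA U) (mulmx1C oX) mulmx1.
have wE : al *m om *m be = U *m V^T.
  by rewrite alomE /be !mulmxA -(mulmxA U) (mulmx1C oY) mulmx1.
(* Here [ln (t + N a)] is bounded below by [ln (N a)]. The squares in a row of [U *m V^T] are
   weights of sum one that average [l] to a diagonal entry of [U L U^T]. *)
have lower : \sum_i t i * (ln N + (U *m L *m U^T) i i - mu 0 i) <=
    \sum_i \sum_j (al *m om *m be) i j ^+ 2 *
       (t i * (ln (t i + N * a j) - ln (t i))).
  apply: ler_sum => i _; rewrite wE (diagonalizes_conj _ _ dL).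
  have -> : ln N + \sum_k (U *m V^T) i k ^+ 2 * l 0 k - mu 0 i =
    \sum_k (U *m V^T) i k ^+ 2 * (ln N + l 0 k - mu 0 i).
    under [RHS]eq_bigr do rewrite mulrBr mulrDr.
    rewrite sumrB big_split/= -!mulr_suml orthogonal_sqr ?mul1r//.
    exact/orthogonal_mul/orthogonal_trmx.
  rewrite mulr_sumr; apply: ler_sum => j _.
  rewrite mulrCA ler_wpM2l ?sqr_ge0// ler_pM2l// /t expRK lerD2r.
  have -> : ln N + l 0 j = ln (N * a j) by rewrite lnM ?posrE// /a expRK.
  have Na : 0 < N * a j by exact: mulr_gt0.
  by rewrite ler_ln ?posrE ?addr_gt0 ?expR_gt0// lerDr ltW ?expR_gt0.
(* [Ekl] is replaced by [ln y + Ekl_inf]. The logarithm rebuilds [ln N] plus a diagonal entry of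
   [U C U^T]. Orthogonality of [om] keeps only [k = l] in the other term, which gives minus the
   entry of [U H U^T], minus one. The errors add up to at most [Se / N], because entries of
   orthogonal matrices are at most one in absolute value. *)
have upper i : \sum_k \sum_l al i k * al i l * (\sum_m om k m * om l m *
     Ekl (th k) (th l) (N * b m)) <=
     ln N + (U *m C *m U^T) i i - (U *m H *m U^T) i i - 1 + eps.
  have -> : ln N + (U *m C *m U^T) i i - (U *m H *m U^T) i i - 1 =
    \sum_k \sum_l al i k * al i l * (\sum_m om k m * om l m *
       (ln (N * b m) + Ekl_inf (th k) (th l))).
    have -> : ln N + (U *m C *m U^T) i i - (U *m H *m U^T) i i - 1 =
      (\sum_k \sum_l al i k * al i l * \sum_m om k m * om l m * ln (N * b m)) +
      (\sum_k \sum_l al i k * al i l *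
         \sum_m om k m * om l m * Ekl_inf (th k) (th l)).
      rewrite -addrA -addrA addrA; congr (_ + _).
        pose D : 'rV[R]_n := \row_m ln (N * b m).
        transitivity ((al *m (om *m diag_mx D *m om^T) *m al^T) i i).
          have -> : al *m (om *m diag_mx D *m om^T) *m al^T =
            (U *m Y^T) *m diag_mx D *m (U *m Y^T)^T.
            by rewrite -alomE (trmx_mul al om) !mulmxA.
          rewrite conj_diagE (diagonalizes_conj _ _ dC).
          under [RHS]eq_bigr do rewrite [D _ _]mxE lnM ?posrE// /b expRK mulrDr.
          rewrite big_split/= -mulr_suml orthogonal_sqr ?mul1r//.
          exact/orthogonal_mul/orthogonal_trmx.
        rewrite mulmx_conj_diag; apply: eq_bigr => k _; apply: eq_bigr => p _.
        congr (_ * _); rewrite mxE; apply: eq_bigr => m _.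
        by rewrite mul_mx_diag !mxE; ring.
      rewrite (diagonalizes_conj _ _ dH) -opprD.
      rewrite -[X in - (_ + X)](orthogonal_sqr i oal) -big_split -sumrN/=.
      apply: eq_bigr => k _.
      have E p : \sum_m om k m * om p m * Ekl_inf (th k) (th p) =
          (k == p)%:R * Ekl_inf (th k) (th p).
        rewrite -mulr_suml; congr (_ * _).
        have /matrixP/(_ k p) := oom; rewrite mxE [1%:M _ _]mxE => <-.
        by apply: eq_bigr => m _; rewrite [om^T _ _]mxE.
      under eq_bigr do rewrite E.
      rewrite (bigD1 k)//= big1 ?addr0 => [|p pk].
        by rewrite eqxx mul1r /Ekl_inf eqxx expRK /al; ring.
      by rewrite eq_sym (negbTE pk) mul0r mulr0.
    rewrite -big_split; apply: eq_bigr => k _ /=.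
    rewrite -big_split; apply: eq_bigr => p _ /=.
    rewrite -mulrDr -big_split; congr (_ * _).
    by apply: eq_bigr => m _ /=; rewrite mulrDr.
  rewrite -lerBlDl -sumrB; apply: le_trans SeN.
  rewrite /Se mulr_suml; apply: ler_sum => k _.
  rewrite mulr_suml -sumrB; apply: ler_sum => p _.
  rewrite mulr_suml -mulrBr -sumrB mulr_sumr; apply: ler_sum => m _.
  rewrite -mulrBr; apply: le_trans (ler_norm _) _.
  rewrite !normrM -[X in _ <= X]mul1r.
  apply: ler_pM; rewrite ?mulr_ge0 ?mulr_ile1 ?orthogonal_le1//.
  rewrite -[X in _ <= X]mul1r.
  apply: ler_pM; rewrite ?mulr_ge0 ?mulr_ile1 ?orthogonal_le1//.
  rewrite -mulrA -invfM [b m * N]mulrC opprD addrA.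
  by case: (eP k p) => _; apply; rewrite mulr_gt0.
have := lieb_integrated om oal obe t0 th0 a0 b0 (ltW N0).
move=> /(le_trans lower) main.
have {}main := le_trans main (lerD (ler_sum _ (fun i _ =>
   ler_wpM2l (ltW (t0 i)) (upper i))) (lexx _)).
rewrite -lerBlDl -sumrB in main.
rewrite mulr_sumr.
under [X in _ <= X]eq_bigr => j _.
  rewrite qform_row (_ : _ *m _ = be^T *m lieb_gram om th b N *m be^T^T).
    over.
  by rewrite /be trmxK trmx_mul trmxK !mulmxA.
apply: le_trans main; apply: ler_sum => i _.
(* Subtracting [upper] from [lower] cancels [ln N], and [M = H - C + L] cancels all diagonal
   entries, leaving [(1 - eps) * t i]. *)
have : (U *m M *m U^T) i i = (U *m H *m U^T) i i - (U *m C *m U^T) i i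
   + (U *m L *m U^T) i i.
  by rewrite ME mulmxDr mulmxDl mulmxBr mulmxBl !mxE.
rewrite (diagonalizes_diag i dM) -/(t i); move: (t i) => ti ->.
by rewrite le_eqVlt; apply/orP; left; apply/eqP; ring.
Qed.

(** * Spectral theorem *)

Lemma cvg_bigsum (K : numFieldType) (T : Type) (F : set_system T)
    {FF : Filter F} (I : Type) (r : seq I) (f : I -> T -> K) (l : I -> K) :
  (forall i, f i x @[x --> F] --> l i) ->
  \sum_(i <- r) f i x @[x --> F] --> \sum_(i <- r) l i.
Proof.
move=> fl; elim: r => [|i r IH].
  by rewrite big_nil; under eq_fun do rewrite big_nil; exact: cvg_cst.
by rewrite big_cons; under eq_fun do rewrite big_cons; exact: cvgD.
Qed.

Lemma continuous_qform (R : realType) n (B : 'M[R]_n) :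
  continuous (fun v : 'rV[R]_n => qform B v).
Proof.
have -> : (fun v : 'rV[R]_n => qform B v) =
    (fun v : 'rV[R]_n => \sum_j (\sum_i v 0 i * B i j) * v 0 j).
  apply/funext => v; rewrite /qform mxE.
  by apply: eq_bigr => j _; rewrite !mxE.
move=> v; apply: (@cvg_bigsum R _ (nbhs v)) => j.
apply: cvgM; last exact: (@coord_continuous R 1 n 0 j v).
apply: (@cvg_bigsum R _ (nbhs v)) => i; apply: cvgM; last exact: cvg_cst.
exact: (@coord_continuous R 1 n 0 i v).
Qed.

Lemma continuous_mulmx_entry (R : realType) n k (B : 'M[R]_(n, k)) i :
  continuous (fun v : 'rV[R]_n => (v *m B) 0 i).
Proof.
have -> : (fun v : 'rV[R]_n => (v *m B) 0 i) =
    (fun v : 'rV[R]_n => \sum_j v 0 j * B j i).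
  by apply/funext => v; rewrite mxE.
move=> v; apply: (@cvg_bigsum R _ (nbhs v)) => j.
apply: cvgM; last exact: cvg_cst.
exact: (@coord_continuous R 1 n 0 j v).
Qed.

Lemma qform1_eq0 (R : realType) n (x : 'rV[R]_n) : qform 1%:M x = 0 -> x = 0.
Proof.
rewrite /qform mulmx1 mxE => /eqP.
rewrite psumr_eq0 => [/allP h|i _]; last by rewrite mxE -expr2 sqr_ge0.
apply/rowP => i; have := h i (mem_index_enum i).
by rewrite !mxE mulf_eq0 orbb => /eqP.
Qed.

Lemma qform1_ge0 (R : realType) n (x : 'rV[R]_n) : 0 <= qform 1%:M x.
Proof.
by rewrite /qform mulmx1 mxE; apply: sumr_ge0 => i _; rewrite mxE -expr2 sqr_ge0.
Qed.

Lemma qformZ (R : realType) n (A : 'M[R]_n) (c : R) (x : 'rV[R]_n) :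
  qform A (c *: x) = c ^+ 2 * qform A x.
Proof.
rewrite /qform linearZ/= -!scalemxAl -scalemxAr scalerA -expr2.
by rewrite mxE.
Qed.

Lemma compact_unit_sphere_cap (R : realType) n k (B : 'M[R]_(n, k)) :
  compact [set v : 'rV[R]_n | qform 1%:M v = 1 /\ v *m B = 0].
Proof.
have box : compact [set v : 'rV[R]_n | forall i, `[(-1 : R), 1]%classic (v ord0 i)].
  apply: (@rV_compact _ _ (fun=> `[(-1 : R), 1]%classic)) => _.
  exact: segment_compact.
apply: subclosed_compact box _.
  rewrite (_ : [set _ | _] =
    ((fun v => qform 1%:M v) @^-1` [set 1]) `&`
    \bigcap_(i in [set: 'I_k]) ((fun v : 'rV[R]_n => (v *m B) 0 i) @^-1` [set 0])).
    apply: closedI.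
      apply: preimage_closed; last exact: closed_eq.
      by move=> v _; exact: continuous_qform.
    apply: closed_bigI => i _.
    apply: preimage_closed; last exact: closed_eq.
    by move=> v _; exact: continuous_mulmx_entry.
  apply/seteqP; split => v /= [v1 vB]; split => //.
    by move=> i _ /=; rewrite vB mxE.
  by apply/rowP => i; rewrite [RHS]mxE; exact: vB.
move=> v /= [v1 _] i; rewrite in_itv/= -ler_norml.
move: v1; rewrite /qform mulmx1 mxE (bigD1 i)//= mxE -expr2 => v1.
have : v 0 i ^+ 2 <= 1.
  rewrite -v1 lerDl sumr_ge0// => j _.
  by rewrite mxE -expr2 sqr_ge0.
by rewrite -real_normK ?num_real// -[X in _ <= X](expr1n _ 2) ler_sqr ?nnegrE.
Qed.

(* Lagrange: a maximiser of the Rayleigh quotient on the orthogonal complement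
   of the rows of [U] is an eigenvector. *)
Lemma exists_orthogonal_eigenvector (R : realType) n k (A : 'M[R]_n)
    (U : 'M[R]_(k, n)) (a : 'rV[R]_k) :
  (k < n)%N -> A^T = A -> U *m A = diag_mx a *m U ->
  exists v : 'rV[R]_n, exists r : R,
    [/\ v *m v^T = 1%:M, v *m U^T = 0 & v *m A = r *: v].
Proof.
move=> kn AT UA.
pose S := [set v : 'rV[R]_n | qform 1%:M v = 1 /\ v *m U^T = 0].
have normalize (x : 'rV[R]_n) : x != 0 -> x *m U^T = 0 ->
    S ((Num.sqrt (qform 1%:M x))^-1 *: x).
  move=> x0 xU; split; last by rewrite -scalemxAl xU scaler0.
  rewrite qformZ exprVn sqr_sqrtr ?qform1_ge0// mulVf//.
  by apply: contra x0 => /eqP/qform1_eq0 ->.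
have S0 : S !=set0.
  have : kermx U^T != 0.
    rewrite -mxrank_eq0 mxrank_ker subn_eq0 -ltnNge.
    by rewrite (leq_ltn_trans (rank_leq_col _)).
  move=> /rowV0Pn[x /sub_kermxP xU x0].
  by exists ((Num.sqrt (qform 1%:M x))^-1 *: x); exact: normalize.
have [v vS vmax] := compact_EVT_max S0 (@compact_unit_sphere_cap R n k U^T)
  (continuous_subspaceT (@continuous_qform R n A)).
have {vS}[v1 vU] := set_mem vS.
pose r := qform A v.
have qmax (x : 'rV[R]_n) : x *m U^T = 0 -> qform A x <= r * qform 1%:M x.
  move=> xU; have [->|x0] := eqVneq x 0.
    by rewrite /qform !mul0mx mxE mulr0.
  have := vmax _ (mem_set (normalize x x0 xU)).
  rewrite qformZ exprVn sqr_sqrtr ?qform1_ge0// mulrC ler_pdivrMr//.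
  rewrite lt0r qform1_ge0 andbT.
  by apply: contra x0 => /eqP/qform1_eq0 ->.
have vv : v *m v^T = 1%:M.
  apply/matrixP => i j; rewrite !ord1 [RHS]mxE eqxx -[RHS]v1.
  by rewrite /qform mulmx1.
exists v, r; split => //.
(* The residual of the eigenvector equation is orthogonal to [v] and to the rows of [U], hence an
   admissible direction of variation. *)
pose g := v *m A - r *: v.
suff : g = 0 by move/eqP; rewrite subr_eq0 => /eqP.
have gU : g *m U^T = 0.
  rewrite mulmxBl -scalemxAl vU scaler0 subr0 -mulmxA.
  by rewrite -[A]AT -trmx_mul UA trmx_mul mulmxA vU mul0mx.
have gv : g *m v^T = 0.
  rewrite mulmxBl -scalemxAl vv; apply/matrixP => i j.
  by rewrite !ord1 !mxE eqxx mulr1; apply/eqP; rewrite subr_eq0 /r /qform mxE.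
have vg : v *m g^T = 0 by rewrite -[v]trmxK -trmx_mul gv trmx0.
have gAv : g *m A *m v^T = g *m g^T.
  have -> : g *m A *m v^T = g *m (v *m A)^T by rewrite trmx_mul AT mulmxA.
  have -> : v *m A = g + r *: v by rewrite /g subrK.
  by rewrite linearD/= linearZ/= mulmxDr -scalemxAr gv scaler0 addr0.
have vAg : v *m A *m g^T = g *m g^T.
  have E : (v *m A *m g^T)^T = g *m A *m v^T.
    by rewrite !trmx_mul trmxK AT mulmxA.
  by rewrite -[LHS]trmxK E gAv trmx_mul trmxK.
clearbody g; pose rho := qform 1%:M g; pose q := qform A g - r * rho.
have rhoE : (g *m g^T) 0 0 = rho by rewrite /rho /qform mulmx1.
(* Maximality is tested at [v + t g]; the first-order term is [2 t |g|^2]. *)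
have key t : 2 * t * rho + t ^+ 2 * q <= 0.
  have := qmax (v + t *: g).
  rewrite mulmxDl vU -scalemxAl gU scaler0 addr0 => /(_ erefl).
  rewrite {1 2}/qform linearD/= linearZ/= mulmx1.
  rewrite !(mulmxDl, mulmxDr) -!(scalemxAl, scalemxAr) gv vg vv gAv vAg.
  have vAv : (v *m A *m v^T) 0 0 = r by [].
  have gAg : (g *m A *m g^T) 0 0 = q + r * rho by rewrite /q subrK.
  have addE (M1 M2 : 'M[R]_1) : (M1 + M2) 0 0 = M1 0 0 + M2 0 0 by rewrite mxE.
  have scaleE c (M1 : 'M[R]_1) : (c *: M1) 0 0 = c * M1 0 0 by rewrite mxE.
  have E1 : (1%:M : 'M[R]_1) 0 0 = 1 by rewrite mxE eqxx.
  have E0 : (0 : 'M[R]_1) 0 0 = 0 by rewrite mxE.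
  rewrite !(addE, scaleE) vAv gAg rhoE E1 E0.
  lra.
apply: qform1_eq0; apply/eqP; rewrite eq_le qform1_ge0 andbT -/rho leNgt.
apply/negP => rho0.
have q1 : 0 < `|q| + 1 by rewrite ltr_pwDr.
(* For this [t] the linear term beats the quadratic one; the [+ 1] guards against [q = 0]. *)
have := key (rho / (`|q| + 1)); apply/negP; rewrite -ltNge.
have -> : 2 * (rho / (`|q| + 1)) * rho + (rho / (`|q| + 1)) ^+ 2 * q =
  rho ^+ 2 / (`|q| + 1) ^+ 2 * (2 * (`|q| + 1) + q).
  by field; rewrite gt_eqF.
rewrite mulr_gt0 ?divr_gt0 ?exprn_gt0//.
have := ler_norm (- q); rewrite normrN; have := normr_ge0 q; lra.
Qed.

(** Orthonormal eigenvectors are collected one at a time as the rows of a [k] by [n] matrix, until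
    [k = n] makes it square and orthogonal. *)
Lemma symmetric_diagonalizes (R : realType) n (A : 'M[R]_n) :
  A^T = A -> exists U, exists a, diagonalizes U a A.
Proof.
move=> AT.
have H k : (k <= n)%N -> exists U : 'M[R]_(k, n), exists a : 'rV[R]_k,
    U *m U^T = 1%:M /\ U *m A = diag_mx a *m U.
  elim: k => [_|k IH kn].
    by exists 0, 0; split; apply/matrixP => -[].
  have [U [a [U1 UA]]] := IH (ltnW kn).
  have [v [r [v1 vU vA]]] := exists_orthogonal_eigenvector kn AT UA.
  rewrite -addn1; exists (col_mx U v), (row_mx a (r%:M)); split.
    have Uv : U *m v^T = 0 by rewrite -[U]trmxK -trmx_mul vU trmx0.
    by rewrite tr_col_mx mul_col_row U1 v1 vU Uv -scalar_mx_block.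
  rewrite mul_col_mx UA vA diag_mx_row mul_block_col !mul0mx addr0 add0r.
  congr col_mx; rewrite -mul_scalar_mx; congr (_ *m _).
  by apply/matrixP => i j; rewrite !ord1 !mxE eqxx.
have [U [a [U1 UA]]] := H n (leqnn n).
exists U, a; split => //.
by rewrite -mulmxA -UA mulmxA (mulmx1C U1) mul1mx.
Qed.

(** * Trace exponential and maximum eigenvalue *)

(** A comparison of [exp y] with its [[2/1]] Pade approximant at [y = z sg]; the sign [sg] reduces
    negative [y] to a variable [z >= 0]. The difference and its first derivative vanish at [0], and
    the second derivative [1 - (1 - y) exp y] is nonnegative since [1 - y <= exp (- y)]. *)
Lemma expR_pade_aux (R : realType) (z sg : R) : sg ^+ 2 = 1 -> 0 <= z ->
  (3 - z * sg) * expR (z * sg) <= 3 + 2 * (z * sg) + z ^+ 2 / 2.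
Proof.
move=> sg2 z0; rewrite -subr_ge0.
have De (x : R) : is_derive x 1 (fun y => expR (y * sg)) (sg * expR (x * sg)).
  by apply: is_derive_dilate; exact: is_derive_expR.
have Da (c x : R) : is_derive x 1 (fun y => c + y * sg) sg by exact: is_derive_affine.
pose k1 y := sg * 2 + y - (sg * 2 - y) * expR (y * sg).
have Dk1 (x : R) : is_derive x 1 k1 (1 - (1 - x * sg) * expR (x * sg)).
  have D1 := is_deriveD (is_derive_cst (sg * 2) x 1) (is_derive_id x (1 : R)).
  have D2 := is_deriveB (is_derive_cst (sg * 2) x 1) (is_derive_id x (1 : R)).
  have D := is_deriveB D1 (is_deriveM D2 (De x)).
  apply: (@is_derive_eq _ _ _ _ _ _ _ _ D).
  rewrite /GRing.scale /= !fctE; move: (expR _) => e.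
  transitivity (1 + e - 2 * sg ^+ 2 * e + x * sg * e); first by ring.
  by rewrite sg2; ring.
have k1_ge0 y : 0 <= y -> 0 <= k1 y.
  move=> y0; have := ge0_derive_ndecr (fun x _ => Dk1 x) _ y0.
  rewrite {1}/k1 mul0r expR0 mulr1 addr0 subr0 subrr; apply.
  move=> x _; rewrite subr_ge0 -ler_pdivlMr ?expR_gt0// div1r -expRN.
  by have := expR_ge1Dx (- (x * sg)).
pose k y := 3 + 2 * (y * sg) + y ^+ 2 / 2 - (3 - y * sg) * expR (y * sg).
have Dk (x : R) : is_derive x 1 k (k1 x).
  have D1 := is_deriveB (is_deriveD (is_deriveD (is_derive_cst (3 : R) x 1)
     (is_derive_mulc 2 (Da 0 x)))
     (is_derive_mulc 2^-1 (is_deriveM (is_derive_id x (1 : R)) (is_derive_id x (1 : R)))))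
     (is_deriveM (is_deriveB (is_derive_cst (3 : R) x 1) (Da 0 x)) (De x)).
  rewrite (_ : k = (fun y => 3 + 2 * (0 + y * sg) + 2^-1 * (y * y) -
     (3 - (0 + y * sg)) * expR (y * sg))); last first.
    by apply/funext => y; rewrite /k; ring.
  apply: (@is_derive_eq _ _ _ _ _ _ _ _ D1).
  rewrite /GRing.scale /= !fctE /k1; move: (expR _) => e.
  transitivity (2 * sg + x - (3 * sg - x * sg ^+ 2 - sg) * e); first by field.
  by rewrite sg2; ring.
have := ge0_derive_ndecr (fun x _ => Dk x) k1_ge0 z0.
rewrite {1}/k mul0r expR0 mulr0 expr0n/= mul0r subr0 !addr0 mulr1 subrr.
exact.
Qed.

(** Dividing the Pade bound by [3 - y] gives the case [x = y], and [1 / (1 - x / 3)] increases with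
    [x]. Only an upper bound on [y] enters, which matches the one-sided bound on the increments. *)
Lemma expR_bernstein (R : realType) (y x : R) : 0 <= x -> x < 3 -> y <= x ->
  expR y <= 1 + y + y ^+ 2 / (2 * (1 - x / 3)).
Proof.
move=> x0 x3 yx.
have h : (3 - y) * expR y <= 3 + 2 * y + y ^+ 2 / 2.
  have [y0|y0] := leP 0 y.
    have := @expR_pade_aux R y 1; rewrite !mulr1 expr1n; exact.
  have := @expR_pade_aux R (- y) (-1).
  by rewrite !mulrN1 !opprK !sqrrN expr1n; apply => //; lra.
have y3 : 0 < 3 - y by lra.
have {h} : expR y <= 1 + y + y ^+ 2 / (2 * (1 - y / 3)).
  rewrite (_ : 1 + y + _ = (3 + 2 * y + y ^+ 2 / 2) / (3 - y)).
    by rewrite ler_pdivlMr// mulrC.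
  by field; rewrite gt_eqF//= gt_eqF//; lra.
move=> /le_trans; apply; rewrite lerD2l ler_wpM2l ?sqr_ge0//.
by rewrite lef_pV2 ?posrE; lra.
Qed.

Section trexp.
Variables (R : realType) (n : nat).
Implicit Types (A B U V : 'M[R]_n) (a : 'rV[R]_n).

(** The power series involves no choice of eigenbasis and is a limit of polynomials in the entries,
    so measurability in [A] is immediate. *)
Definition trexp A : R := limn (series (fun k => \tr (A ^+ k) / k`!%:R)).

Lemma diagonalizes_exp U a A k : diagonalizes U a A ->
  \tr (A ^+ k) = \sum_i a 0 i ^+ k.
Proof.
move=> dA; have [oU AE] := dA.
have E : A ^+ k = U^T *m diag_mx (\row_i a 0 i ^+ k) *m U.
  elim: k => [|k IH].
    rewrite expr0 (_ : diag_mx _ = 1%:M) ?mulmx1 ?(mulmx1C oU)//.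
    by apply/matrixP => i j; rewrite !mxE expr0.
  rewrite exprS IH {1}AE -mulmxE !mulmxA -(mulmxA _ U) oU mulmx1.
  congr (_ *m _); rewrite -mulmxA; congr (_ *m _).
  apply/matrixP => i j; rewrite mul_diag_mx !mxE exprS.
  by case: eqP => [->|]; rewrite ?mulr1n// !mulr0n mulr0.
rewrite E mxtrace_mulC mulmxA oU mul1mx mxtrace_diag.
by apply: eq_bigr => i _; rewrite mxE.
Qed.

Lemma trexp_cvg U a A : diagonalizes U a A ->
  series (fun k => \tr (A ^+ k) / k`!%:R) @ \oo --> \sum_i expR (a 0 i).
Proof.
move=> dA.
have -> : series (fun k => \tr (A ^+ k) / k`!%:R) =
    (fun m => \sum_i series (exp_coeff (a 0 i)) m).
  apply/funext => m; rewrite /series /= exchange_big; apply: eq_bigr => k _ /=.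
  by rewrite (diagonalizes_exp _ dA) mulr_suml.
apply: (@cvg_bigsum R _ \oo) => i.
exact: is_cvg_series_exp_coeff.
Qed.

Lemma trexpE U a A : diagonalizes U a A -> trexp A = \sum_i expR (a 0 i).
Proof. by move=> /trexp_cvg/cvg_lim; apply. Qed.

Lemma trexp0 : trexp (0 : 'M[R]_n) = n%:R.
Proof.
have d0 : diagonalizes 1%:M (0 : 'rV[R]_n) (0 : 'M[R]_n).
  by split; rewrite /orthogonal ?trmx1 ?mulmx1// linear0 mulmx0.
rewrite (trexpE d0); under eq_bigr do rewrite mxE expR0.
by rewrite sumr_const card_ord.
Qed.

Lemma trexp_ge0 A : A^T = A -> 0 <= trexp A.
Proof.
move=> /symmetric_diagonalizes[U [a /trexpE ->]].
by apply: sumr_ge0 => i _; exact: expR_ge0.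
Qed.

(** The graph of [exp] lies above its tangent at the mean [y]. *)
Lemma expR_jensen (I : finType) (w x : I -> R) : (forall i, 0 <= w i) ->
  \sum_i w i = 1 -> expR (\sum_i w i * x i) <= \sum_i w i * expR (x i).
Proof.
move=> w0 w1; set y := \sum_i w i * x i.
have -> : expR y = \sum_i w i * (expR y * (1 + (x i - y))).
  under eq_bigr do rewrite mulrCA mulrDr mulr1 mulrBr.
  rewrite -mulr_sumr big_split sumrB/= -mulr_suml w1 mul1r.
  by rewrite -/y subrr addr0 mulr1.
apply: ler_sum => i _; rewrite ler_wpM2l//.
rewrite -ler_pdivlMl ?expR_gt0// -expRN -expRD [- y + _]addrC.
exact: expR_ge1Dx.
Qed.

Lemma qform_diagonalizes U a A (x : 'rV[R]_n) : diagonalizes U a A ->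
  qform A x = \sum_i (x *m U^T) 0 i ^+ 2 * a 0 i.
Proof.
move=> [_ ->]; rewrite /qform.
have -> : x *m (U^T *m diag_mx a *m U) *m x^T =
    (x *m U^T) *m diag_mx a *m (x *m U^T)^T.
  by rewrite trmx_mul trmxK !mulmxA.
rewrite mxE; apply: eq_bigr => i _; rewrite mul_mx_diag [_^T _ _]mxE [_ 0 i]mxE.
by ring.
Qed.

Lemma orthogonal_qform1 U (x : 'rV[R]_n) : orthogonal U ->
  \sum_i (x *m U^T) 0 i ^+ 2 = qform 1%:M x.
Proof.
move=> oU; rewrite /qform mulmx1.
have -> : x *m x^T = (x *m U^T) *m (x *m U^T)^T.
  by rewrite trmx_mul trmxK mulmxA -(mulmxA x) (mulmx1C oU) mulmx1.
by rewrite mxE; apply: eq_bigr => i _; rewrite [_^T _ _]mxE expr2.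
Qed.

Lemma qform1_row U i : orthogonal U -> qform 1%:M (row i U) = 1.
Proof. by move=> oU; rewrite qform_row mulmx1 oU mxE eqxx. Qed.

Lemma qform_row_diag U a A i : diagonalizes U a A ->
  qform A (row i U) = a 0 i.
Proof. by move=> dA; rewrite qform_row (diagonalizes_diag _ dA). Qed.

Lemma expR_qform_le U a A (x : 'rV[R]_n) : diagonalizes U a A ->
  qform 1%:M x = 1 ->
  expR (qform A x) <= \sum_i (x *m U^T) 0 i ^+ 2 * expR (a 0 i).
Proof.
move=> dA x1; rewrite (qform_diagonalizes _ dA).
apply: expR_jensen => [i|]; first exact: sqr_ge0.
by rewrite orthogonal_qform1 ?x1//; case: dA.
Qed.

(** Expanding the eigenvectors of [A] in the eigenbasis of [B] gives doubly stochastic weights: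
    Jensen's inequality uses the sums over [j], and the sums over [i] recover [trexp B]. *)
Lemma trexp_le A B (k : R) : A^T = A -> B^T = B ->
  (forall x, qform A x <= qform B x + k * qform 1%:M x) ->
  trexp A <= expR k * trexp B.
Proof.
move=> /symmetric_diagonalizes[U [a dA]] /symmetric_diagonalizes[V [b dB]] AB.
have [oU _] := dA; have [oV _] := dB.
rewrite (trexpE dA) (trexpE dB).
have H i : expR (a 0 i) <=
    expR k * \sum_j (row i U *m V^T) 0 j ^+ 2 * expR (b 0 j).
  rewrite -(qform_row_diag i dA).
  apply: (@le_trans _ _ (expR (k + qform B (row i U)))).
    by rewrite ler_expR addrC (le_trans (AB _))// qform1_row// mulr1.
  by rewrite expRD ler_pM2l ?expR_gt0// expR_qform_le// qform1_row.
apply: le_trans (ler_sum _ (fun i _ => H i)) _.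
rewrite -mulr_sumr ler_pM2l ?expR_gt0// exchange_big/=.
rewrite le_eqVlt; apply/orP; left; apply/eqP; apply: eq_bigr => j _.
rewrite -mulr_suml -[RHS]mul1r; congr (_ * _).
have o : orthogonal (V *m U^T) by exact/orthogonal_mul/orthogonal_trmx.
rewrite -(orthogonal_sqr j o); apply: eq_bigr => i _.
rewrite -row_mul mxE; congr (_ ^+ 2).
by rewrite -[U *m _]trmxK trmx_mul trmxK mxE.
Qed.

(** * Maximum eigenvalue as a Rayleigh quotient *)

Lemma diagonalizes_eigenvalue U a A r : diagonalizes U a A ->
  eigenvalue A r -> exists i, r = a 0 i.
Proof.
move=> [oU ->] /eigenvalueP[v vA v0].
pose y := v *m U^T.
have yE : y *m diag_mx a = r *: y.
  rewrite /y scalemxAl -vA !mulmxA -(mulmxA _ U) oU mulmx1.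
  by rewrite -mulmxA.
have y0 : y != 0.
  apply: contra v0 => /eqP y0.
  by rewrite -[v]mulmx1 -(mulmx1C oU) mulmxA -/y y0 mul0mx.
have /rV0Pn[i yi] := y0; exists i.
have /matrixP/(_ 0 i) := yE; rewrite mul_mx_diag !mxE mulrC => /eqP.
rewrite -subr_eq0 -mulrBl mulf_eq0 => /orP[|].
  by rewrite subr_eq0 => /eqP.
by move: yi; rewrite /y mxE => /negbTE ->.
Qed.

Lemma eigenvalue_diagonalizes U a A i : diagonalizes U a A ->
  eigenvalue A (a 0 i).
Proof.
move=> [oU ->]; apply/eigenvalueP; exists (row i U).
  rewrite -row_mul !mulmxA oU mul1mx row_mul row_diag_mx.
  by rewrite -scalemxAl -rowE.
apply/eqP => U0; have := orthogonal_sqr i oU.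
rewrite big1 => [/esym/eqP|j _]; first by rewrite oner_eq0.
by have /rowP/(_ j) := U0; rewrite !mxE => ->; rewrite expr0n.
Qed.

Lemma gamma_max_attained U a A : (0 < n)%N -> diagonalizes U a A ->
  exists2 i, gamma_max A = a 0 i & forall j, a 0 j <= a 0 i.
Proof.
move=> n0 dA.
pose i := [arg max_(i > Ordinal n0) a 0 i]%O.
have imax j : a 0 j <= a 0 i by rewrite /i; case: arg_maxP => //= k _; exact.
exists i => //; rewrite /gamma_max.
have ub : ubound [set r | eigenvalue A r] (a 0 i).
  by move=> r /= /(diagonalizes_eigenvalue dA)[j ->].
have mem : [set r | eigenvalue A r] (a 0 i).
  exact: (eigenvalue_diagonalizes i dA).
apply/eqP; rewrite eq_le; apply/andP; split.
  by apply: ge_sup => //; exists (a 0 i).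
by apply: ub_le_sup => //; exists (a 0 i).
Qed.

Lemma qform_le_gamma_max A (x : 'rV[R]_n) : (0 < n)%N -> A^T = A ->
  qform A x <= gamma_max A * qform 1%:M x.
Proof.
move=> n0 /symmetric_diagonalizes[U [a dA]].
have [i -> amax] := gamma_max_attained n0 dA.
rewrite (qform_diagonalizes _ dA) -(orthogonal_qform1 _ (proj1 dA)) mulr_sumr.
by apply: ler_sum => j _; rewrite mulrC ler_wpM2r ?sqr_ge0.
Qed.

Lemma gamma_max_qform A : (0 < n)%N -> A^T = A ->
  exists2 x, qform 1%:M x = 1 & qform A x = gamma_max A.
Proof.
move=> n0 /symmetric_diagonalizes[U [a dA]].
have [i -> _] := gamma_max_attained n0 dA.
exists (row i U); first by rewrite qform1_row//; case: dA.
exact: qform_row_diag.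
Qed.

Lemma expR_qform_trexp A (x : 'rV[R]_n) : A^T = A -> qform 1%:M x = 1 ->
  expR (qform A x) <= trexp A.
Proof.
move=> /symmetric_diagonalizes[U [a dA]] x1; rewrite (trexpE dA).
apply: le_trans (expR_qform_le dA x1) _; apply: ler_sum => i _.
rewrite ler_piMl ?expR_ge0// -x1 -(orthogonal_qform1 _ (proj1 dA)).
by rewrite (bigD1 i)//= lerDl sumr_ge0// => j _; exact: sqr_ge0.
Qed.

Lemma qformD A B (x : 'rV[R]_n) : qform (A + B) x = qform A x + qform B x.
Proof. by rewrite /qform mulmxDr mulmxDl mxE. Qed.

Lemma qformN A (x : 'rV[R]_n) : qform (- A) x = - qform A x.
Proof. by rewrite /qform mulmxN mulNmx mxE. Qed.

Lemma qform_scale (c : R) A (x : 'rV[R]_n) : qform (c *: A) x = c * qform A x.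
Proof. by rewrite /qform -scalemxAr -scalemxAl mxE. Qed.

(** A unit top eigenvector of [A] attains the first term, and there the quadratic form of [B] is at
    most [gamma_max B]. Thus a line crossing forces the trace exponential to be large. *)
Lemma expR_gamma_max_le A B (l p : R) : (0 < n)%N -> A^T = A -> B^T = B ->
  0 <= p ->
  expR (l * gamma_max A - p * gamma_max B) <= trexp (l *: A - p *: B).
Proof.
move=> n0 AT BT p0; have [x x1 <-] := gamma_max_qform n0 AT.
apply: (@le_trans _ _ (expR (qform (l *: A - p *: B) x))).
  rewrite ler_expR qformD qformN !qform_scale lerD2l lerN2 ler_wpM2l//.
  by have := qform_le_gamma_max x n0 BT; rewrite x1 mulr1.
apply: expR_qform_trexp => //.
by rewrite linearB/= !linearZ/= AT BT.
Qed.

(** The sequence lies between [gamma_max A] and [gamma_max A + ln n / (k + 1)]. It exhibits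
    [gamma_max] as a limit of measurable functions of the entries. *)
Lemma gamma_max_trexp_cvg A : (0 < n)%N -> A^T = A ->
  (fun k => ln (trexp (k.+1%:R *: A)) / k.+1%:R) @ \oo --> gamma_max A.
Proof.
move=> n0 AT.
have upper k : ln (trexp (k.+1%:R *: A)) / k.+1%:R <=
    gamma_max A + ln n%:R * k.+1%:R^-1.
  have k0 : 0 < k.+1%:R :> R by rewrite ltr0n.
  have T0 : 0 < trexp (k.+1%:R *: A).
    have [x x1 _] := gamma_max_qform n0 AT.
    apply: lt_le_trans (expR_qform_trexp (x := x) _ x1); first exact: expR_gt0.
    by rewrite linearZ/= AT.
  have E : trexp (k.+1%:R *: A) <= expR (k.+1%:R * gamma_max A) * n%:R.
    rewrite -trexp0; apply: trexp_le; rewrite ?trmx0// ?linearZ/= ?AT//.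
    move=> x; rewrite qform_scale {2}/qform mulmx0 mul0mx mxE add0r -mulrA.
    by rewrite ler_pM2l// qform_le_gamma_max.
  rewrite ler_pdivrMr// mulrDl divfK ?gt_eqF// [_ * k.+1%:R]mulrC.
  rewrite -[k.+1%:R * _]expRK -lnM ?posrE ?expR_gt0 ?ltr0n//.
  by rewrite ler_ln ?posrE ?mulr_gt0 ?expR_gt0 ?ltr0n.
have lower k : gamma_max A <= ln (trexp (k.+1%:R *: A)) / k.+1%:R.
  have k0 : 0 < k.+1%:R :> R by rewrite ltr0n.
  rewrite ler_pdivlMr// mulrC -[X in X <= _]expRK.
  have := expR_gamma_max_le k.+1%:R n0 AT AT (lexx 0).
  rewrite mul0r subr0 scale0r subr0 => h.
  by rewrite ler_ln ?posrE ?expR_gt0// (lt_le_trans _ h)// expR_gt0.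
apply: (@squeeze_cvgr _ _ _ _ (fun=> gamma_max A)
  (fun k => gamma_max A + ln n%:R * k.+1%:R^-1)).
- by apply: nearW => k; rewrite lower upper.
- exact: cvg_cst.
- rewrite -[X in _ --> X]addr0; apply: cvgD; first exact: cvg_cst.
  rewrite -[X in _ --> X](mulr0 (ln n%:R)); apply: cvgM; first exact: cvg_cst.
  exact: cvg_harmonic.
Qed.

(** The Frobenius inner product, written entrywise because conditional expectations are taken entry
    by entry. *)
Definition mxdot A B : R := \sum_i \sum_j A i j * B i j.

Lemma mxdot_diagonalizes V a (G : 'M[R]_n) :
  mxdot G (V^T *m diag_mx a *m V) = \sum_j a 0 j * qform G (row j V).
Proof.
rewrite /mxdot; transitivity (\sum_i \sum_j \sum_k a 0 k * (V k i * G i j * V k j)).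
  apply: eq_bigr => i _; apply: eq_bigr => j _; rewrite mxE mulr_sumr.
  by apply: eq_bigr => k _; rewrite mul_mx_diag !mxE; ring.
under eq_bigr do rewrite exchange_big.
rewrite exchange_big; apply: eq_bigr => k _ /=.
under eq_bigr do rewrite -mulr_sumr.
rewrite -mulr_sumr; congr (_ * _).
rewrite qform_row mxE exchange_big; apply: eq_bigr => j _ /=.
by rewrite !mxE mulr_suml.
Qed.

(* [exp (l x) <= 1 + l x + psi x ^ 2] for [x <= b], while
   [1 + psi c <= exp (psi c)] on the side of [C]. *)
Lemma freedman_tangent (H C : 'M[R]_n) (b l eps : R) :
  (0 < n)%N -> H^T = H -> C^T = C -> 0 < b -> 0 < l -> l * b < 3 -> 0 < eps ->
  let psi := l ^+ 2 / (2 * (1 - l * b / 3)) in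
  exists G : 'M[R]_n, [/\ forall D, D^T = D -> (forall x, 0 <= qform D x) ->
      0 <= mxdot G D,
    mxdot G (1%:M + psi *: C) <= trexp H &
    forall X, X^T = X ->
      0 <= mxdot G (1%:M + l *: X + psi *: (X *m X)) /\
      (gamma_max X <= b ->
       (1 - eps) * trexp (H - psi *: C + l *: X) <=
       mxdot G (1%:M + l *: X + psi *: (X *m X)))].
Proof.
move=> n0 HT CT b0 l0 lb eps0 psi.
have lb0 : 0 < l * b by rewrite mulr_gt0.
have psi0 : 0 < psi by rewrite divr_gt0 ?exprn_gt0//; lra.
have [X0 [h dH]] := symmetric_diagonalizes HT.
have [Y [c dC]] := symmetric_diagonalizes CT.
have dC' : diagonalizes Y (psi *: c) (psi *: C).
  case: dC => oY ->; split => //.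
  by rewrite linearZ/= -scalemxAr -scalemxAl.
have [G [Gpsd GB Glieb]] := lieb_tangent dH dC' eps0.
have diag1 (V : 'M[R]_n) : orthogonal V -> 1%:M = V^T *m diag_mx (\row_i 1) *m V.
  move=> oV; rewrite (_ : diag_mx _ = 1%:M) ?mulmx1 ?(mulmx1C oV)//.
  by apply/matrixP => i j; rewrite !mxE.
exists G; split.
- move=> D /symmetric_diagonalizes[V [r dD]] D0; have [_ ->] := dD.
  rewrite mxdot_diagonalizes; apply: sumr_ge0 => j _; rewrite mulr_ge0//.
  by rewrite -(qform_row_diag j dD).
- rewrite (trexpE dH); apply: le_trans GB.
  case: dC' => oY ->; rewrite {1}(diag1 Y oY) -mulmxDl -mulmxDr -linearD/=.
  rewrite mxdot_diagonalizes; apply: ler_sum => j _; rewrite ler_wpM2r//.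
  by rewrite !mxE; exact: expR_ge1Dx.
move=> X XT; have [V [x dX]] := symmetric_diagonalizes XT.
have [oV XE] := dX.
have EX : 1%:M + l *: X + psi *: (X *m X) =
   V^T *m diag_mx (\row_i (1 + l * x 0 i + psi * x 0 i ^+ 2)) *m V.
  have XX : X *m X = V^T *m diag_mx (\row_i x 0 i ^+ 2) *m V.
    rewrite XE !mulmxA -(mulmxA _ V) oV mulmx1 -(mulmxA _ (diag_mx x) (diag_mx x)).
    congr (_ *m _ *m _); apply/matrixP => i j.
    rewrite mul_diag_mx !mxE expr2.
    by case: eqP => [->|]; rewrite ?mulr1n// !mulr0n mulr0.
  have S k (D : 'M[R]_n) : k *: (V^T *m D *m V) = V^T *m (k *: D) *m V.
    by rewrite -scalemxAr -scalemxAl.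
  rewrite XX {1}XE {1}(diag1 V oV) !S -!mulmxDl -!mulmxDr.
  congr (_ *m _ *m _); apply/matrixP => i j; rewrite !mxE.
  by case: eqP => _; rewrite ?mulr1n// !mulr0n !mulr0 !addr0.
(* Hence [1 + l x + psi x^2] is at least [((1 + l x)^2 + 1) / 2] and is nonnegative for every [x],
   including where the almost sure bound on [X] fails. *)
have psi1 : l ^+ 2 / 2 <= psi.
  rewrite ler_pM2l ?exprn_gt0// lef_pV2 ?posrE//; lra.
split.
  rewrite EX mxdot_diagonalizes; apply: sumr_ge0 => j _; rewrite mulr_ge0//.
  rewrite mxE; have : l ^+ 2 / 2 * x 0 j ^+ 2 <= psi * x 0 j ^+ 2.
    by rewrite ler_wpM2r ?sqr_ge0.
  have : 0 <= (l * x 0 j + 1) ^+ 2 by exact: sqr_ge0.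
  by rewrite sqrrD exprMn expr1n mulr1; lra.
move=> Xb.
have dL : diagonalizes V (l *: x) (l *: X).
  by split => //; rewrite XE linearZ/= -scalemxAr -scalemxAl.
have MT : (H - psi *: C + l *: X)^T = H - psi *: C + l *: X.
  by rewrite !linearD/= linearN/= !linearZ/= HT CT XT.
have [U [mu dM]] := symmetric_diagonalizes MT.
rewrite (trexpE dM); apply: le_trans (Glieb _ _ _ _ _ _ dL dM erefl) _.
rewrite EX mxdot_diagonalizes; apply: ler_sum => j _; rewrite ler_wpM2r//.
have xb : x 0 j <= b.
  have [i gi imax] := gamma_max_attained n0 dX.
  by rewrite (le_trans _ Xb)// gi.
rewrite !mxE (le_trans (expR_bernstein (x := l * b) _ _ _))//.
- exact: ltW.
- by rewrite ler_pM2l.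
- by rewrite exprMn /psi mulrAC.
Qed.

End trexp.

(** * Supermartingale property *)

Section measurable_mx.
Variables (R : realType) (disp : measure_display) (T : measurableType disp).
Variable (n : nat).
Implicit Types A B : T -> 'M[R]_n.

Definition measurable_mx A : Prop :=
  forall i j, measurable_fun [set: T] (fun w => A w i j).

Lemma measurable_mxD A B : measurable_mx A -> measurable_mx B ->
  measurable_mx (fun w => A w + B w).
Proof.
move=> mA mB i j; under eq_fun do rewrite mxE.
exact: measurable_funD.
Qed.

Lemma measurable_mxZ (c : R) A : measurable_mx A ->
  measurable_mx (fun w => c *: A w).
Proof.
move=> mA i j; under eq_fun do rewrite mxE.
exact: measurable_funM.
Qed.

Lemma measurable_mxN A : measurable_mx A -> measurable_mx (fun w => - A w).
Proof. by move=> /(measurable_mxZ (-1)); under eq_fun do rewrite scaleN1r. Qed.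

Lemma measurable_mxB A B : measurable_mx A -> measurable_mx B ->
  measurable_mx (fun w => A w - B w).
Proof. by move=> mA /measurable_mxN; exact: measurable_mxD. Qed.

Lemma measurable_mx_cst (M : 'M[R]_n) : measurable_mx (fun=> M).
Proof. by move=> i j; exact: measurable_cst. Qed.

Lemma measurable_mx_sum (I : Type) (r : seq I) (A : I -> T -> 'M[R]_n) :
  (forall i, measurable_mx (A i)) -> measurable_mx (fun w => \sum_(i <- r) A i w).
Proof.
move=> mA; elim: r => [|i r IH].
  by under eq_fun do rewrite big_nil; exact: measurable_mx_cst.
by under eq_fun do rewrite big_cons; exact: measurable_mxD.
Qed.

Lemma measurable_mxM A B : measurable_mx A -> measurable_mx B ->
  measurable_mx (fun w => A w *m B w).
Proof.
move=> mA mB i j; under eq_fun do rewrite mxE.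
by apply: measurable_sum => k; exact: measurable_funM.
Qed.

Lemma measurable_mxX A k : measurable_mx A -> measurable_mx (fun w => A w ^+ k).
Proof.
move=> mA; elim: k => [|k IH].
  by under eq_fun do rewrite expr0; exact: measurable_mx_cst.
by under eq_fun do rewrite exprS -mulmxE; exact: measurable_mxM.
Qed.

Lemma measurable_trexp A : measurable_mx A -> (forall w, (A w)^T = A w) ->
  measurable_fun [set: T] (fun w => trexp (A w)).
Proof.
move=> mA AT.
apply: (@measurable_fun_cvg _ T R setT
  (fun m w => series (fun k => \tr (A w ^+ k) / k`!%:R) m)).
  move=> m; rewrite /series /=; apply: measurable_sum => k.
  apply: measurable_funM => //; rewrite /mxtrace; apply: measurable_sum => i.
  exact: measurable_mxX.
move=> w _; have [U [a dA]] := symmetric_diagonalizes (AT w).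
by rewrite (trexpE dA); exact: trexp_cvg dA.
Qed.

Lemma measurable_gamma_max A : (0 < n)%N -> measurable_mx A ->
  (forall w, (A w)^T = A w) -> measurable_fun [set: T] (fun w => gamma_max (A w)).
Proof.
move=> n0 mA AT.
apply: (@measurable_fun_cvg _ T R setT
  (fun k w => ln (trexp (k.+1%:R *: A w)) / k.+1%:R)).
  move=> k; apply: measurable_funM => //; apply: measurableT_comp => //.
  apply: measurable_trexp; first exact: measurable_mxZ.
  by move=> w; rewrite linearZ/= AT.
by move=> w _; exact: gamma_max_trexp_cvg.
Qed.

End measurable_mx.

(** * Equality of integrals under linear combinations *)

Section equal_integrals.
Variables (R : realType) (disp : measure_display) (T : measurableType disp).
Variables (mu : {finite_measure set T -> \bar R}) (D : set T).
Hypothesis mD : measurable D.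
Implicit Types f g : T -> R.

Definition equal_integrals f g : Prop :=
  [/\ mu.-integrable D (EFin \o f), mu.-integrable D (EFin \o g) &
     (\int[mu]_(w in D) (f w)%:E = \int[mu]_(w in D) (g w)%:E)%E].

Lemma equal_integralsD f g f' g' :
  equal_integrals f g -> equal_integrals f' g' ->
  equal_integrals (fun w => f w + f' w) (fun w => g w + g' w).
Proof.
move=> [if1 ig1 e1] [if2 ig2 e2].
split; [exact: integrableD if1 if2|exact: integrableD ig1 ig2|].
transitivity (\int[mu]_(w in D) ((EFin \o f) \+ (EFin \o f')) w)%E => //.
rewrite integralD_EFin// e1 e2 -integralD_EFin//.
Qed.

Lemma equal_integralsZ (c : R) f g : equal_integrals f g ->
  equal_integrals (fun w => c * f w) (fun w => c * g w).
Proof.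
move=> [if1 ig1 e1].
split; [exact: integrableZl if1|exact: integrableZl ig1|].
transitivity (\int[mu]_(w in D) (c%:E * (EFin \o f) w))%E => //.
rewrite integralZl// e1 -integralZl//.
Qed.

Lemma equal_integrals_cst (c : R) : equal_integrals (fun=> c) (fun=> c).
Proof. by split => //; exact: finite_measure_integrable_cst. Qed.

Lemma equal_integrals_sum (I : Type) (r : seq I) (f g : I -> T -> R) :
  (forall i, equal_integrals (f i) (g i)) ->
  equal_integrals (fun w => \sum_(i <- r) f i w) (fun w => \sum_(i <- r) g i w).
Proof.
move=> fg; elim: r => [|i r IH].
  by under [X in equal_integrals X _]eq_fun do rewrite big_nil;
     under [X in equal_integrals _ X]eq_fun do rewrite big_nil;
     exact: equal_integrals_cst.
under [X in equal_integrals X _]eq_fun do rewrite big_cons.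
under [X in equal_integrals _ X]eq_fun do rewrite big_cons.
exact: equal_integralsD.
Qed.

End equal_integrals.

(** Each product satisfies [|x_i x_j| <= (x_i^2 + x_j^2) / 2], and the double sum counts every
    square [n] times. *)
Lemma qform_entry_bound (R : realType) n (M : 'M[R]_n) (delta : R) (x : 'rV[R]_n) :
  (forall i j, `|M i j| <= delta) -> `|qform M x| <= n%:R * delta * qform 1%:M x.
Proof.
move=> Md; rewrite /qform mulmx1.
have -> : n%:R * delta * (x *m x^T) 0 0 =
    \sum_j \sum_i delta * ((x 0 i ^+ 2 + x 0 j ^+ 2) / 2).
  have E : (x *m x^T) 0 0 = \sum_i x 0 i ^+ 2.
    by rewrite mxE; apply: eq_bigr => i _; rewrite mxE expr2.
  under eq_bigr do rewrite -mulr_sumr -mulr_suml big_split/= sumr_const card_ord.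
  rewrite -mulr_sumr -mulr_suml big_split/= sumr_const card_ord sumrMnl -E.
  move: ((x *m x^T) 0 0) => S.
  rewrite (_ : S *+ n = S * n%:R); first by field.
  by rewrite mulr_natr.
rewrite mxE (le_trans (ler_norm_sum _ _ _))//; apply: ler_sum => j _.
rewrite mxE mulr_suml (le_trans (ler_norm_sum _ _ _))//; apply: ler_sum => i _.
rewrite [x^T _ _]mxE !normrM mulrAC mulrC.
apply: ler_pM; rewrite ?mulr_ge0//.
rewrite -[x 0 i ^+ 2]real_normK ?num_real// -[x 0 j ^+ 2]real_normK ?num_real//.
have := sqr_ge0 (`|x 0 i| - `|x 0 j|); rewrite sqrrB; lra.
Qed.

(* On a set where [H] and [C] are almost constant, a single supergradient [G]
   works for all points, so no measurable selection of [G] is needed. *)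
Lemma freedman_cell (R : realType) (disp : measure_display)
    (T : measurableType disp) (P : probability T R) (n : nat)
    (H C X : T -> 'M[R]_n) (b l psi eps delta : R) (D : set T) (w0 : T) :
  (0 < n)%N -> measurable D -> D w0 ->
  measurable_mx H -> measurable_mx C -> measurable_mx X ->
  (forall w, (H w)^T = H w) -> (forall w, (C w)^T = C w) ->
  (forall w, (X w)^T = X w) ->
  0 < b -> 0 < l -> l * b < 3 -> 0 < eps -> eps < 1 ->
  (forall w i j, D w -> `|H w i j - H w0 i j| <= delta) ->
  (forall w i j, D w -> `|C w i j - C w0 i j| <= delta) ->
  {ae P, forall w, gamma_max (X w) <= b} ->
  (forall i j, equal_integrals P D (fun w => X w i j) (fun=> 0)) ->
  (forall i j, equal_integrals P D (fun w => (X w *m X w) i j)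
    (fun w => C w i j)) ->
  psi = l ^+ 2 / (2 * (1 - l * b / 3)) ->
  (\int[P]_(w in D) (trexp (H w - psi *: C w + l *: X w))%:E <=
   (expR (2 * (1 + psi) * (n%:R * delta)) / (1 - eps))%:E *
     \int[P]_(w in D) (trexp (H w))%:E)%E.
Proof.
move=> n0 mD Dw0 mH mC mX HT CT XT b0 l0 lb eps0 eps1 Hd Cd Xb EX EXX psiE.
have psi0 : 0 <= psi.
  rewrite psiE.
  have : 0 < l * b by exact: mulr_gt0.
  by move=> lb0; rewrite divr_ge0 ?sqr_ge0//; lra.
set nd := n%:R * delta.
(* On [D] the shifted matrix dominates every [C w], and exceeds it by at most [2 nd] on unit
   vectors. *)
pose C1 := C w0 + nd *: 1%:M.
have C1T : C1^T = C1 by rewrite linearD/= linearZ/= CT trmx1.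
have [G [Gpsd GC1 GX]] := freedman_tangent n0 (HT w0) C1T b0 l0 lb eps0.
rewrite -psiE in GC1 GX.
have qH w x : D w -> `|qform (H w) x - qform (H w0) x| <= nd * qform 1%:M x.
  move=> Dw; rewrite -qformN -qformD; apply: qform_entry_bound => i j.
  by rewrite !mxE; exact: Hd.
have qC w x : D w -> `|qform (C w) x - qform (C w0) x| <= nd * qform 1%:M x.
  move=> Dw; rewrite -qformN -qformD; apply: qform_entry_bound => i j.
  by rewrite !mxE; exact: Cd.
have qC1 x : qform C1 x = qform (C w0) x + nd * qform 1%:M x.
  by rewrite /C1 qformD qform_scale.
clearbody C1.
pose f w := mxdot G (1%:M + l *: X w + psi *: (X w *m X w)).
pose g w := mxdot G (1%:M + psi *: C w).
have f0 w : 0 <= f w by case: (GX _ (XT w)).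
have fg : equal_integrals P D f g.
  apply: (equal_integrals_sum mD) => i; apply: (equal_integrals_sum mD) => j.
  apply: (equal_integralsZ mD).
  under [X in equal_integrals _ _ X _]eq_fun do rewrite 5!mxE.
  under [X in equal_integrals _ _ _ X]eq_fun do rewrite 3!mxE.
  have := equal_integralsD mD (equal_integralsD mD
    (equal_integrals_cst P mD ((i == j)%:R : R))
    (equal_integralsZ mD l (EX i j))) (equal_integralsZ mD psi (EXX i j)).
  by under [X in equal_integrals _ _ _ X -> _]eq_fun do rewrite mulr0 addr0.
have [if_ ig_ Efg] := fg.
(* The cost of moving [H w] to [H w0] is [nd], that of moving [psi C w] to [psi C1] is [2 psi nd],
   and [1 - eps] comes from the tangent inequality. Moving [H w0] back to [H w] in [step2] costs
   another [nd]. *)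
pose K1 := expR (nd + psi * (2 * nd)) / (1 - eps).
have K10 : 0 <= K1 by rewrite divr_ge0 ?expR_ge0//; lra.
have step1 w : D w -> gamma_max (X w) <= b ->
    trexp (H w - psi *: C w + l *: X w) <= K1 * f w.
  move=> Dw Xwb.
  have [_ /(_ Xwb) h] := GX _ (XT w).
  rewrite /K1 mulrAC -mulrA.
  apply: (@le_trans _ _ (expR (nd + psi * (2 * nd)) *
      trexp (H w0 - psi *: C1 + l *: X w))); last first.
    rewrite ler_pM2l ?expR_gt0// mulrC ler_pdivlMl; last lra.
    exact: h.
  apply: trexp_le.
  - by rewrite !(linearD, linearN, linearZ)/= HT CT XT.
  - by rewrite !(linearD, linearN, linearZ)/= HT C1T XT.
  move=> x; rewrite !qformD !qformN !qform_scale qC1.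
  have := qH w x Dw; rewrite ler_norml => /andP[_ h1].
  have := qC w x Dw; rewrite ler_norml => /andP[h2 _].
  have h3 : psi * (- (nd * qform 1%:M x)) <= psi * (qform (C w) x - qform (C w0) x).
    by rewrite ler_wpM2l.
  lra.
have step2 w : D w -> g w <= expR nd * trexp (H w).
  move=> Dw; apply: (@le_trans _ _ (trexp (H w0))).
    apply: le_trans GC1; rewrite -subr_ge0.
    have -> : mxdot G (1%:M + psi *: C1) - g w = psi * mxdot G (C1 - C w).
      rewrite /g /mxdot -sumrB mulr_sumr; apply: eq_bigr => i _.
      rewrite -sumrB mulr_sumr; apply: eq_bigr => j _; rewrite !mxE.
      by ring.
    rewrite mulr_ge0//; apply: Gpsd => [|x].
      by rewrite linearB/= C1T CT.
    rewrite qformD qformN qC1.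
    by have := qC w x Dw; rewrite ler_norml => /andP[_]; lra.
  apply: trexp_le => // x.
  by have := qH w x Dw; rewrite ler_norml => /andP[]; lra.
have mU : measurable_fun [set: T] (fun w => trexp (H w - psi *: C w + l *: X w)).
  apply: measurable_trexp.
    by apply: measurable_mxD; [apply: measurable_mxB => //|]; exact: measurable_mxZ.
  by move=> w; rewrite !(linearD, linearN, linearZ)/= HT CT XT.
have mtH : measurable_fun [set: T] (fun w => trexp (H w)).
  exact: measurable_trexp.
have UT w : 0 <= trexp (H w - psi *: C w + l *: X w).
  by apply: trexp_ge0; rewrite !(linearD, linearN, linearZ)/= HT CT XT.
have mD' h : measurable_fun [set: T] h -> measurable_fun D (EFin \o h : T -> \bar R).
  by move=> mh; apply/measurable_EFinP; exact: measurable_funTS.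
have mf := measurable_int P if_; have mg := measurable_int P ig_.
apply: (@le_trans _ _ (\int[P]_(w in D) (K1%:E * (f w)%:E))%E).
  apply: ae_ge0_le_integral => //.
  - by move=> w _; rewrite lee_fin.
  - exact: mD' mU.
  - by move=> w _; rewrite -EFinM lee_fin mulr_ge0.
  - exact: measurable_funeM.
  - case: Xb => N [mN N0 hN]; exists N; split => // w /= nw; apply: hN => /= h.
    by apply: nw => Dw; rewrite -EFinM lee_fin; exact: step1.
rewrite ge0_integralZl_EFin//; last by move=> w _; rewrite lee_fin.
rewrite Efg.
have -> : expR (2 * (1 + psi) * nd) / (1 - eps) = K1 * expR nd.
  by rewrite /K1 [RHS]mulrAC -expRD; congr (expR _ / _); ring.
rewrite (EFinM K1) -muleA; apply: lee_wpmul2l; first by rewrite lee_fin.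
rewrite -ge0_integralZl_EFin ?expR_ge0//; last 2 first.
  - by move=> w _; rewrite lee_fin trexp_ge0.
  - exact: mD' mtH.
(* On [D] the trace exponential of [H] is bounded by [exp nd] times its value at [w0]. *)
have iH : P.-integrable D (fun w => (expR nd)%:E * (trexp (H w))%:E)%E.
  have [+ _ _] := equal_integrals_cst P mD
    (expR nd * (expR nd * trexp (H w0))).
  apply: le_integrable => //; first exact/measurable_funeM/mD'.
  move=> w Dw; rewrite -EFinM lee_fin.
  rewrite !ger0_norm ?mulr_ge0 ?expR_ge0 ?trexp_ge0//.
  rewrite ler_pM2l ?expR_gt0//; apply: trexp_le => // x.
  by have := qH w x Dw; rewrite ler_norml => /andP[]; lra.
apply: le_integral => // w /set_mem Dw.
by rewrite -EFinM lee_fin; exact: step2.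
Qed.

(** * Countable partitions into cells of small oscillation *)

Section measurable_wrt.
Variables (R : realType) (disp : measure_display) (T : measurableType disp).
Variable G : set (set T).
Hypothesis hG : sigma_algebra setT G.
Let TG := g_sigma_algebraType G.

Lemma measurable_wrtP (f : T -> R) :
  measurable_wrt G f <-> measurable_fun [set: TG] (f : TG -> R).
Proof.
split=> [mf _ B mB|mf B mB].
  by rewrite setTI /TG measurable_g_measurableTypeE//; exact: mf.
have := mf measurableT B mB.
by rewrite setTI /TG measurable_g_measurableTypeE.
Qed.

(** The values of each [f i] are sorted into intervals of length [delta], and one member of each
    cover [A j] is selected. Such choices are countably many, and the resulting cells are then made
    disjoint. *)
Lemma countable_partition (I J : finType) (f : I -> T -> R)
    (A : J -> nat -> set T) (delta : R) :
  0 < delta -> (forall i, measurable_wrt G (f i)) ->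
  (forall j m, G (A j m)) -> (forall j, \bigcup_m A j m = setT) ->
  exists D : nat -> set T, [/\ forall k, G (D k), trivIset setT D,
    \bigcup_k D k = setT,
    forall k i w w', D k w -> D k w' -> `|f i w - f i w'| <= delta &
    forall k j, exists m, D k `<=` A j m].
Proof.
move=> d0 mf mA Acov.
pose B (x : {ffun I -> int} * {ffun J -> nat}) :=
  (\bigcap_(i in [set: I])
     (f i @^-1` [set` `[(x.1 i)%:~R * delta, (x.1 i + 1)%:~R * delta[%R])) `&`
  \bigcap_(j in [set: J]) A j (x.2 j).
have mB x : (measurable : set (set TG)) (B x).
  apply: measurableI; apply: fin_bigcap_measurable; try exact: finite_finset.
    move=> i _; have /measurable_wrtP/(_ measurableT) := mf i.
    by move=> /(_ [set` `[(x.1 i)%:~R * delta, (x.1 i + 1)%:~R * delta[%R] (measurable_itv _)); rewrite setTI.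
  by move=> j _; rewrite measurable_g_measurableTypeE.
(* A number that codes no choice gives the empty cell. *)
pose D0 k := if unpickle k is Some x then B x else set0.
have mD0 k : (measurable : set (set TG)) (D0 k).
  by rewrite /D0; case: unpickle.
exists (seqDU D0); split => //.
- move=> k; have := seqDU_measurable mD0 k.
  by rewrite measurable_g_measurableTypeE.
- rewrite -seqDU_bigcup_eq -subTset => w _.
  have /choice[m hm] : forall j, exists m, A j m w.
    by move=> j; have : (\bigcup_m A j m) w; [rewrite Acov|case=> m _; exists m].
  pose x := ([ffun i => Num.floor (f i w / delta)], [ffun j => m j]).
  exists (pickle x) => //; rewrite /D0 pickleK; split => [i _|j _] /=.
    have /andP[h1 h2] := real_floor_itv (num_real (f i w / delta)).
    rewrite in_itv/= ffunE; apply/andP; split.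
      by rewrite -ler_pdivlMr.
    by rewrite -ltr_pdivrMr.
  by rewrite ffunE.
- move=> k i w w' Dw Dw'.
  move: (@subset_seqDU _ D0 k w Dw) (@subset_seqDU _ D0 k w' Dw').
  rewrite /D0; case: unpickle => [x|//] [/(_ i Logic.I) + _] [/(_ i Logic.I) + _].
  rewrite /= !in_itv/= => /andP[h1 h2] /andP[h3 h4].
  rewrite rmorphD/= mulrDl mul1r in h2 h4.
  by rewrite ler_norml; lra.
- move=> k j; case E : (unpickle k : option ({ffun I -> int} * {ffun J -> nat})) => [x|].
    exists (x.2 j); apply: subset_trans (@subset_seqDU _ D0 k) _.
    by rewrite /D0 E => w [_ /(_ j Logic.I)].
  exists 0%N; apply: subset_trans (@subset_seqDU _ D0 k) _.
  by rewrite /D0 E.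
Qed.

End measurable_wrt.

Lemma lee_mul_gt1 (R : realType) (x y : \bar R) : (0 <= y)%E ->
  (forall r : R, 1 < r -> (x <= r%:E * y)%E) -> (x <= y)%E.
Proof.
move=> y0 h; case: y y0 h => [y y0 h|_ _|//]; last exact: leey.
rewrite lee_fin in y0; apply/lee_addgt0Pr => e e0.
have r1 : 1 < 1 + e / (y + 1) by rewrite ltrDl divr_gt0//; lra.
apply: le_trans (h _ r1) _; rewrite -EFinM lee_fin.
rewrite mulrDl mul1r lerD2l mulrAC ler_pdivrMr; last lra.
by rewrite ler_pM2l//; lra.
Qed.

(** The event [E] is cut into cells on which [H] and [C] oscillate little and the entries of
    [X *m X] are integrable. On each cell [freedman_cell] gives the inequality up to a factor [r],
    and [r > 1] is arbitrary. *)
Lemma freedman_step (R : realType) (disp : measure_display)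
    (T : measurableType disp) (P : probability T R) (n : nat)
    (G : set (set T)) (H C X : T -> 'M[R]_n) (b l psi : R) (E : set T) :
  sigma_algebra setT G -> G `<=` measurable -> (0 < n)%N ->
  (forall i j, measurable_wrt G (fun w => H w i j)) ->
  measurable_mx X ->
  (forall w, (H w)^T = H w) -> (forall w, (C w)^T = C w) ->
  (forall w, (X w)^T = X w) ->
  0 < b -> 0 < l -> l * b < 3 ->
  psi = l ^+ 2 / (2 * (1 - l * b / 3)) ->
  {ae P, forall w, gamma_max (X w) <= b} ->
  (forall i j, P.-integrable setT (fun w => (X w i j)%:E)) ->
  (forall A i j, G A -> (\int[P]_(w in A) (X w i j)%:E = 0)%E) ->
  is_condexp_mx P G (fun w => X w *m X w) C ->
  G E ->
  (\int[P]_(w in E) (trexp (H w - psi *: C w + l *: X w))%:E <=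
     \int[P]_(w in E) (trexp (H w))%:E)%E.
Proof.
move=> hG GM n0 mH mX HT CT XT b0 l0 lb psiE Xb iX EX hC GE.
have psi0 : 0 <= psi.
  rewrite psiE; have : 0 < l * b by exact: mulr_gt0.
  by move=> lb0; rewrite divr_ge0 ?sqr_ge0//; lra.
have mGT (f : T -> R) : measurable_wrt G f -> measurable_fun [set: T] f.
  by move=> mf _ B mB; rewrite setTI; exact/GM/mf.
have mC i j : measurable_wrt G (fun w => C w i j) by case: (hC i j).
have mHT : measurable_mx H by move=> i j; exact/mGT/mH.
have mCT : measurable_mx C by move=> i j; exact/mGT/mC.
have GI A B : G A -> G B -> G (A `&` B).
  move=> GA GB; rewrite -(measurable_g_measurableTypeE hG).
  by apply: measurableI; rewrite (measurable_g_measurableTypeE hG).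
have nT w : 0 <= trexp (H w) by exact: trexp_ge0.
have UT w : (H w - psi *: C w + l *: X w)^T = H w - psi *: C w + l *: X w.
  by rewrite !(linearD, linearN, linearZ)/= HT CT XT.
have mU : measurable_fun [set: T] (fun w => trexp (H w - psi *: C w + l *: X w)).
  apply: measurable_trexp => //.
  by apply: measurable_mxD; [apply: measurable_mxB => //|]; exact: measurable_mxZ.
have mtH : measurable_fun [set: T] (fun w => trexp (H w)).
  exact: measurable_trexp.
have mD' A h : measurable_fun [set: T] h ->
    measurable_fun A (EFin \o h : T -> \bar R).
  by move=> mh; apply/measurable_EFinP; exact: measurable_funTS.
apply: lee_mul_gt1 => [|r r1]; first by apply: integral_ge0 => w _; rewrite lee_fin.
(* The loss [r = exp (2 rho)] is shared equally: the mesh [rho / kap] costs [exp rho], and so does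
   [eps = 1 - exp (- rho)]. *)
pose rho := ln r / 2.
have rho0 : 0 < rho by rewrite divr_gt0// ln_gt0.
pose kap : R := 2 * (1 + psi) * n%:R.
have kap0 : 0 < kap by rewrite !mulr_gt0 ?ltr0n//; lra.
have [A hA] : exists A : 'I_n * 'I_n -> nat -> set T, forall ij,
    [/\ forall m, G (A ij m), \bigcup_m A ij m = setT
      & forall m, P.-integrable (A ij m) (EFin \o (fun w => (X w *m X w) ij.1 ij.2))].
  have : forall ij : 'I_n * 'I_n, exists A : nat -> set T,
    [/\ forall m, G (A m), \bigcup_m A m = setT
      & forall m, P.-integrable (A m) (EFin \o (fun w => (X w *m X w) ij.1 ij.2))].
    by move=> ij; case: (hC ij.1 ij.2).
  by move=> /choice[A hA]; exists A.
pose f (i : 'I_n * 'I_n + 'I_n * 'I_n) w : R :=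
  match i with inl ij => H w ij.1 ij.2 | inr ij => C w ij.1 ij.2 end.
have mf i : measurable_wrt G (f i) by case: i => -[].
have [D [GD tD UD Df DA]] := countable_partition hG
  (divr_gt0 rho0 kap0) mf (fun ij m => let: And3 h _ _ := hA ij in h m)
  (fun ij => let: And3 _ h _ := hA ij in h).
have mED k : measurable (E `&` D k) by exact/GM/GI.
have EU : E = \bigcup_k (E `&` D k) by rewrite -setI_bigcupr UD setIT.
have tED : trivIset setT (fun k => E `&` D k) by exact: trivIset_setIl.
rewrite EU !ge0_integral_bigcup//; last 4 first.
- exact: mD'.
- by move=> w _; rewrite lee_fin.
- exact: mD'.
- by move=> w _; rewrite lee_fin trexp_ge0.
rewrite -nneseriesZl; last first.
  by move=> k _; apply: integral_ge0 => w _; rewrite lee_fin.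
apply: lee_nneseries => [k _ _|k _].
  by apply: integral_ge0 => w _; rewrite lee_fin trexp_ge0.
have [->|/set0P[w0 [Ew0 Dw0]]] := eqVneq (E `&` D k) set0.
  by rewrite !integral_set0 mule0.
have -> : r = expR (2 * (1 + psi) * (n%:R * (rho / kap))) / (1 - (1 - expR (- rho))).
  rewrite subKr -expRN opprK -expRD.
  rewrite (_ : _ + rho = ln r); first by rewrite lnK// posrE; lra.
  rewrite mulrA -/kap /rho; field.
  by rewrite gt_eqF.
have GED : G (E `&` D k) by exact: GI.
apply: (freedman_cell (w0 := w0) (b := b)) => //.
- by rewrite subr_gt0 -expR0 ltr_expR oppr_lt0.
- by rewrite ltrBlDr ltrDl expR_gt0.
- by move=> w i j [_ Dw]; exact: (Df k (inl (i, j))).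
- by move=> w i j [_ Dw]; exact: (Df k (inr (i, j))).
- move=> i j; split.
  + exact: (integrableS measurableT (mED k) _ (iX i j)).
  + by have [] := equal_integrals_cst P (mED k) (0 : R).
  + by rewrite EX// integral0.
- move=> i j; have [_ _ /(_ _ GED) hint] := hC i j.
  have iXX : P.-integrable (E `&` D k) (EFin \o (fun w => (X w *m X w) i j)).
    have [m Dm] := DA k (i, j); have [GA _ /(_ m)] := hA (i, j).
    apply: integrableS => //; first exact/GM/GA.
    by apply: subset_trans Dm; exact: subIsetr.
  split => //; last by rewrite hint.
  (* The entries of [C] are integrable over the cell because they are bounded there. *)
  have [+ _ _] := equal_integrals_cst P (mED k) (`|C w0 i j| + rho / kap).
  apply: le_integrable => //; first exact: mD'.
  move=> w [_ Dw]; rewrite lee_fin [X in _ <= X]ger0_norm; last first.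
    by rewrite addr_ge0// divr_ge0// ltW.
  rewrite -lerBlDl; apply: le_trans (lerB_dist _ _) _.
  exact: (Df k (inr (i, j))).
Qed.

(** The process is stopped when it first reaches [a]: [a] times the mass already stopped, plus the
    integral of [L N] over the rest, never exceeds the initial integral. *)
Lemma ville (R : realType) (disp : measure_display) (T : measurableType disp)
    (P : probability T R) (F : nat -> set (set T)) (L : nat -> T -> R) (a : R) :
  filtration F -> (forall t, measurable_wrt (F t) (L t)) ->
  (forall t w, 0 <= L t w) ->
  (forall t E, F t E ->
    (\int[P]_(w in E) (L t.+1 w)%:E <= \int[P]_(w in E) (L t w)%:E)%E) ->
  0 < a ->
  measurable [set w | exists t, a <= L t w] /\
  (a%:E * P [set w | exists t, (a <= L t w)%R] <= \int[P]_w (L 0%N w)%:E)%E.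
Proof.
move=> [sF FM FS] mL L0 Lsuper a0.
have FI t A B : F t A -> F t B -> F t (A `&` B).
  move=> FA FB; rewrite -(measurable_g_measurableTypeE (sF t)).
  by apply: measurableI; rewrite (measurable_g_measurableTypeE (sF t)).
pose below t := [set w | L t w < a].
have Fbelow t : F t (below t).
  have -> : below t = L t @^-1` [set` `]-oo, a[%R].
    by apply/seteqP; split => w; rewrite /below /= in_itv.
  exact: (mL t _ (measurable_itv _)).
(* [Rst N] is the event of staying below [a] at all times before [N], so [Rst N.+1] already belongs
   to [F N], as the supermartingale property requires. *)
pose Rst := fix Rst N := if N is N'.+1 then Rst N' `&` below N' else [set: T].
have FR N : F N (Rst N).
  elim: N => [|N IH] /=; last exact/FS/FI.
  by case: (sF 0%N) => F0 FC _; rewrite -(setD0 setT); exact: FC.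
have mR N : measurable (Rst N) by exact: FM (FR N).
have mLT t : measurable_fun [set: T] (L t).
  by move=> _ B mB; rewrite setTI; exact: FM (mL t _ mB).
have mLE t A : measurable_fun A (EFin \o L t).
  by apply/measurable_EFinP; exact: measurable_funTS.
have inv N : (a%:E * P (~` Rst N) + \int[P]_(w in Rst N) (L N w)%:E <=
    \int[P]_w (L 0%N w)%:E)%E.
  elim: N => [|N IH]; first by rewrite /= setCT measure0 mule0 add0e.
  apply: le_trans IH.
  (* The mass stopped exactly at time [N], where [L N] is at least [a]. *)
  pose EN := Rst N `\` below N.
  have mbN : measurable (below N) by exact: FM (Fbelow N).
  have mEN : measurable EN by exact: measurableD.
  have RN : Rst N = EN `|` Rst N.+1 by rewrite /= setUC setUIDK.
  have dRN : [disjoint EN & Rst N.+1].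
    by apply/disj_setPS => w [[_ nb] [_ b]].
  have -> : ~` Rst N.+1 = ~` Rst N `|` EN.
    rewrite /= setCI /EN setDE; apply/seteqP; split => w /=.
      by case: (pselect (Rst N w)) => [Rw [//|bw]|nR _]; [right|left].
    by case=> [nR|[_ bw]]; [left|right].
  rewrite measureU//; last 2 first.
  - exact: measurableC.
  - by apply/seteqP; split => w //= [nR [Rw _]].
  rewrite [in X in (_ <= _ + X)%E]RN ge0_integral_setU//; last 2 first.
  - by rewrite -RN; exact: mLE.
  - by move=> w _; rewrite lee_fin.
  rewrite ge0_muleDr// -addeA; apply: leeD => //; apply: leeD.
    rewrite -integral_cst//; apply: ge0_le_integral => //.
    - by move=> w _; rewrite lee_fin ltW.
    - exact: mLE.
    - by move=> w [_ /negP]; rewrite -leNgt lee_fin.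
  apply: Lsuper; exact: FI.
have UE : [set w | exists t, a <= L t w] = \bigcup_N ~` Rst N.
  apply/seteqP; split => w /=.
    move=> [t at_]; exists t.+1 => //= -[_]; rewrite /below /= ltNge.
    by rewrite at_.
  move=> [N _]; elim: N => [|N IH] //= /not_andP[/IH//|/negP].
  by rewrite -leNgt => h; exists N.
have mU : measurable [set w | exists t, a <= L t w].
  by rewrite UE; apply: bigcup_measurable => N _; exact: measurableC.
split => //.
have bnd N : (P (~` Rst N) <= a^-1%:E * \int[P]_w (L 0%N w)%:E)%E.
  rewrite -(@lee_pmul2l _ a%:E) ?lte_fin// muleA -EFinM divff ?gt_eqF// mul1e.
  by apply: le_trans (inv N); rewrite leeDl// integral_ge0// => w _; rewrite lee_fin.
rewrite muleC -lee_pdivlMr// muleC UE.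
have cv : P \o (fun N => ~` Rst N) @ \oo --> P (\bigcup_N ~` Rst N).
  apply: nondecreasing_cvg_mu.
  - by move=> N; exact: measurableC.
  - by rewrite -UE.
  - apply/nondecreasing_seqP => N; rewrite subsetEset.
    by apply: subsetC => w /= [].
by apply: (cvge_le _ cv); apply: nearW => N; exact: bnd.
Qed.

(** * Line crossing and stitching *)

(** Ville's inequality at level [exp x] for [tr (exp (l Y_t - psi W_t))], which starts at
    [tr (exp 0) = d]. *)
Lemma freedman_line (R : realType) (disp : measure_display)
    (T : measurableType disp) (P : probability T R)
    (F : nat -> set (set T)) (d : nat) (b : R)
    (Y CE : nat -> T -> 'M[R]_d) (l psi x : R) :
  filtration F -> (0 < d)%N -> 0 < b ->
  (forall t w, symmetric_mx (Y t w)) -> martingale_mx P F Y ->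
  (forall w, Y 0%N w = 0) ->
  (forall t, (1 <= t)%N ->
    {ae P, forall w, gamma_max (Y t w - Y t.-1 w) <= b}) ->
  (forall i w, (1 <= i)%N -> symmetric_mx (CE i w)) ->
  (forall i, (1 <= i)%N -> is_condexp_mx P (F i.-1)
     (fun w => (Y i w - Y i.-1 w) *m (Y i w - Y i.-1 w)) (CE i)) ->
  0 < l -> l * b < 3 -> psi = l ^+ 2 / (2 * (1 - l * b / 3)) ->
  exists E : set T, [/\ measurable E,
    forall t w, x <= l * gamma_max (Y t w) -
      psi * gamma_max (\sum_(1 <= i < t.+1) CE i w) -> E w &
    (P E <= (d%:R * expR (- x))%:E)%E].
Proof.
move=> hF d0 b0 Ysym [Ymeas Yint Ymart] Y0 Yb CEsym hCE l0 lb psiE.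
have [sF FM FS] := hF.
have psi0 : 0 <= psi.
  rewrite psiE; have : 0 < l * b by exact: mulr_gt0.
  by move=> lb0; rewrite divr_ge0 ?sqr_ge0//; lra.
pose W t w := \sum_(1 <= i < t.+1) CE i w.
have W0 w : W 0%N w = 0 by rewrite /W big_geq.
have WS t w : W t.+1 w = W t w + CE t.+1 w by rewrite /W big_nat_recr.
have WT t w : (W t w)^T = W t w.
  elim: t => [|t IH]; first by rewrite W0 trmx0.
  by rewrite WS linearD/= IH CEsym.
pose U t w := l *: Y t w - psi *: W t w.
have UT t w : (U t w)^T = U t w.
  by rewrite /U linearB/= !linearZ/= Ysym WT.
have mW t i j : measurable_wrt (F t) (fun w => W t w i j).
  elim: t => [|t IH].
    under eq_fun do rewrite W0.
    by apply/(measurable_wrtP (sF 0%N)); exact: measurable_cst.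
  under eq_fun do rewrite WS mxE.
  apply/(measurable_wrtP (sF t.+1)); apply: measurable_funD.
    by apply/(measurable_wrtP (sF t.+1)) => B mB; exact/FS/IH.
  apply/(measurable_wrtP (sF t.+1)) => B mB; apply: FS.
  by have [mC _ _] := hCE t.+1 isT i j; exact: mC.
have mU t i j : measurable_wrt (F t) (fun w => U t w i j).
  apply/(measurable_wrtP (sF t)).
  have mY' : @measurable_mx R _ (g_sigma_algebraType (F t)) d (Y t).
    by move=> i' j'; apply/(measurable_wrtP (sF t)); exact: Ymeas.
  have mW' : @measurable_mx R _ (g_sigma_algebraType (F t)) d (W t).
    by move=> i' j'; apply/(measurable_wrtP (sF t)); exact: mW.
  exact: (measurable_mxB (measurable_mxZ l mY') (measurable_mxZ psi mW')).
have mL t : measurable_wrt (F t) (fun w => trexp (U t w)).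
  apply/(measurable_wrtP (sF t)).
  apply: (@measurable_trexp R _ (g_sigma_algebraType (F t)) d (U t)) => // i j.
  by apply/(measurable_wrtP (sF t)); exact: mU.
have Lsuper t E : F t E -> (\int[P]_(w in E) (trexp (U t.+1 w))%:E <=
    \int[P]_(w in E) (trexp (U t w))%:E)%E.
  move=> FE; have mE : measurable E by exact: FM FE.
  have -> : (fun w => (trexp (U t.+1 w))%:E) = (fun w =>
      (trexp (U t w - psi *: CE t.+1 w + l *: (Y t.+1 w - Y t w)))%:E).
    apply/funext => w; congr ((trexp _)%:E).
    by rewrite /U WS; apply/matrixP => i j; rewrite !mxE; ring.
  apply: (@freedman_step _ _ _ _ _ (F t) (U t) (CE t.+1)
    (fun w => Y t.+1 w - Y t w) b l psi E (sF t) (FM t)) => //.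
  - apply: measurable_mxB => i j _ B mB; rewrite setTI.
      exact: FM (Ymeas t.+1 i j B mB).
    exact: FM (Ymeas t i j B mB).
  - by move=> w; exact: CEsym.
  - by move=> w; rewrite linearB/= !Ysym.
  - exact: (Yb t.+1).
  - move=> i j; under eq_fun do rewrite 2!mxE EFinB.
    exact: integrableB (Yint t.+1 i j) (Yint t i j).
  - move=> A i j FA; have mA : measurable A by exact: FM FA.
    have iY t' : P.-integrable A (EFin \o (fun w => Y t' w i j)).
      by apply: integrableS (Yint t' i j).
    under eq_integral do rewrite 2!mxE EFinB.
    rewrite integralB_EFin//.
    have [_ _ /(_ A FA (iY t.+1)) <-] := Ymart t i j.
    rewrite subee//; apply: integrable_fin_num => //; exact: iY.
  - exact: (hCE t.+1).
have L0 t w : 0 <= trexp (U t w) by exact: trexp_ge0.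
have [mE PE] := ville hF mL L0 Lsuper (expR_gt0 x).
exists [set w | exists t, expR x <= trexp (U t w)]; split => //.
  move=> t w xle; exists t.
  apply: le_trans (expR_gamma_max_le l d0 (Ysym t w) (WT t w) psi0).
  by rewrite ler_expR.
have I0 : (\int[P]_w (trexp (U 0%N w))%:E = d%:R%:E)%E.
  under eq_integral => w _ do
    rewrite /U Y0 W0 !scaler0 subrr trexp0.
  rewrite integral_cst// -[RHS]mule1; congr (_ * _)%E; exact: probability_setT.
rewrite I0 in PE.
rewrite -(@lee_pmul2l _ (expR x)%:E) ?lte_fin ?expR_gt0// -EFinM.
by rewrite expRN mulrC divfK ?gt_eqF ?expR_gt0.
Qed.

(** * Zeta series and epochs *)

Lemma powR_telescope (R : realType) (p y : R) : 0 < p -> 1 <= y ->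
  p * ((y + 1) `^ (p + 1))^-1 <= y `^ (- p) - (y + 1) `^ (- p).
Proof.
move=> p0 y1; have y0 : 0 < y by lra.
have yp : 0 < y + 1 by lra.
have -> : ((y + 1) `^ (p + 1))^-1 = (y + 1) `^ (- p) / (y + 1).
  rewrite powRD; last by rewrite (gt_eqF yp) implybT.
  by rewrite powRr1 1?ltW// invfM powRN.
rewrite mulrCA lerBrDr -[X in _ + X <= _]mulr1 -mulrDr.
(* After division by [(y + 1)^(- p)] the claim follows from [1 + z <= exp z] and [ln (1 - u) <= - u]
   with [u = 1 / (y + 1)]. *)
have -> : y `^ (- p) = (y + 1) `^ (- p) * expR (- p * (ln y - ln (y + 1))).
  by rewrite /powR !gt_eqF// -expRD; congr expR; ring.
rewrite ler_pM2l ?powR_gt0// addrC.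
apply: le_trans (expR_ge1Dx _); rewrite lerD2l mulNr -mulrN ler_pM2l//.
have := @le_ln1Dx R (- (y + 1)^-1).
have -> : 1 + - (y + 1)^-1 = y / (y + 1) by field; rewrite gt_eqF.
rewrite ln_div ?posrE// ltrN2 invf_lt1// => /(_ ltac:(lra)).
by rewrite opprB; lra.
Qed.

(** Comparison with the telescoping differences of [k^(- p) / p], where [p = s - 1]; the partial
    sums stay below [1 + 1 / p]. *)
Lemma cvg_riemannR (R : realType) (s : R) : 1 < s -> cvgn (series (riemannR s)).
Proof.
move=> s1; pose p := s - 1; have p0 : 0 < p by rewrite /p; lra.
have u0 k : 0 < riemannR s k by apply: riemannR_gt0; lra.
apply: nondecreasing_is_cvgn.
  by apply/nondecreasing_seqP => k; rewrite /series/= big_nat_recr//= lerDl ltW.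
exists (1 + p^-1) => _ [n _ <-].
have H k : series (riemannR s) k.+1 <= 1 + (1 - k.+1%:R `^ (- p)) / p.
  elim: k => [|k IH].
    by rewrite /series/= big_nat1 /riemannR !powR1 invr1 subrr mul0r addr0.
  rewrite /series/= big_nat_recr//=.
  have := @powR_telescope R p k.+1%:R p0 _; rewrite ler1n => /(_ isT).
  rewrite natr1 (_ : p + 1 = s); last by rewrite /p subrK.
  rewrite -ler_pdivlMl// => h.
  apply: le_trans (lerD IH h) _.
  by rewrite le_eqVlt; apply/orP; left; apply/eqP; field; rewrite gt_eqF.
apply: (@le_trans _ _ (series (riemannR s) n.+1)).
  by rewrite /series/= big_nat_recr//= lerDl ltW.
by apply: le_trans (H n) _; rewrite lerD2l -[X in _ <= X]mul1r ler_pM2r ?invr_gt0.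
Qed.

Lemma zeta_ge1 (R : realType) (s : R) : 1 < s -> 1 <= zeta s.
Proof.
move=> s1.
have u0 k : 0 < riemannR s k by apply: riemannR_gt0; lra.
have nd : nondecreasing_seq (series (riemannR s)).
  by apply/nondecreasing_seqP => k; rewrite /series/= big_nat_recr//= lerDl ltW.
have := nondecreasing_cvgn_le nd (cvg_riemannR s1) 1%N.
by rewrite /series/= big_nat1 /riemannR powR1 invr1.
Qed.

(** [x] minimises [L / x + x v0 / 2] at the geometric midpoint [v0] of the epoch. At another [v] the
    value is [sqrt (L v / 2)] times [r + 1 / r], with [r = sqrt (v0 / v)] between [eta^(-1/4)] and
    [eta^(1/4)]; this is the source of [k1]. *)
Lemma epoch_tangent (R : realType) (eta m L lv v : R) (k : nat) :
  1 < eta -> 0 < m -> 0 < L -> L <= lv ->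
  m * eta ^+ k <= v -> v <= m * eta ^+ k.+1 ->
  let x := Num.sqrt (2 * L / (m * eta ^+ k * Num.sqrt eta)) in
  0 < x /\ L / x + x * v / 2 <= k1 eta * Num.sqrt (v * lv).
Proof.
move=> eta1 m0 L0 Llv v1 v2; have eta0 : 0 < eta by lra.
set v0 := m * eta ^+ k * Num.sqrt eta => x.
have mk0 : 0 < m * eta ^+ k by rewrite mulr_gt0// exprn_gt0.
have v00 : 0 < v0 by rewrite mulr_gt0// sqrtr_gt0.
have vp : 0 < v by lra.
pose e := eta `^ 4^-1.
have e0 : 0 < e by exact: powR_gt0.
have ee : e ^+ 2 = Num.sqrt eta.
  rewrite -powR12_sqrt ?ltW// expr2 -powRD; last by rewrite gt_eqF// implybT.
  by congr (_ `^ _); field.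
have e4 : e ^+ 4 = eta by rewrite (exprM e 2 2) ee sqr_sqrtr// ltW.
pose A := Num.sqrt L; pose B := Num.sqrt v; pose D := Num.sqrt v0.
pose r2 : R := Num.sqrt 2.
have A0 : 0 < A by rewrite sqrtr_gt0.
have B0 : 0 < B by rewrite sqrtr_gt0.
have D0 : 0 < D by rewrite sqrtr_gt0.
have r20 : 0 < r2 by rewrite sqrtr_gt0.
have r22 : r2 ^+ 2 = 2 by rewrite sqr_sqrtr.
have A2 : L = A ^+ 2 by rewrite sqr_sqrtr// ltW.
have B2 : v = B ^+ 2 by rewrite sqr_sqrtr// ltW.
have D2 : v0 = D ^+ 2 by rewrite sqr_sqrtr// ltW.
have xE : x = r2 * A / D.
  by rewrite /x sqrtrM ?mulr_ge0 ?ltW// sqrtrV ?ltW// sqrtrM.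
have sqr_le y z : 0 < y -> 0 < z -> y ^+ 2 <= z ^+ 2 -> y <= z.
  by move=> y0 z0; rewrite ler_sqr// nnegrE ltW.
have BD : B <= e * D.
  apply: sqr_le => //; first exact: mulr_gt0.
  rewrite exprMn -B2 -D2 ee; apply: le_trans v2 _.
  by rewrite /v0 mulrCA -expr2 sqr_sqrtr ?(ltW eta0)// exprSr mulrA.
have DB : D <= e * B.
  apply: sqr_le => //; first exact: mulr_gt0.
  by rewrite exprMn -B2 -D2 ee /v0 mulrC ler_pM2l// sqrtr_gt0.
split; first by rewrite xE divr_gt0// mulr_gt0.
have -> : L / x + x * v / 2 = A * B / r2 * (D / B + B / D).
  have -> : 2^-1 = (r2 ^+ 2)^-1 by rewrite r22.
  by rewrite xE B2 A2; field; rewrite !gt_eqF.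
have -> : k1 eta = (e + e^-1) / r2 by rewrite /k1 powRN.
apply: (@le_trans _ _ ((e + e^-1) / r2 * (A * B))).
  rewrite (_ : (e + e^-1) / r2 * (A * B) = A * B / r2 * (e + e^-1)).
    rewrite ler_pM2l ?divr_gt0 ?mulr_gt0// -subr_ge0.
    (* The gap between [e + 1 / e] and [D / B + B / D] factors, and [BD] and [DB] make both factors
       nonnegative. *)
    rewrite (_ : _ - _ = (e * B - D) * (e * D - B) / (e * B * D)).
      by rewrite divr_ge0 ?mulr_ge0 ?subr_ge0// ltW.
    by field; rewrite !gt_eqF.
  by field; rewrite !gt_eqF.
rewrite ler_pM2l; last by rewrite divr_gt0// addr_gt0// invr_gt0.
have -> : A * B = Num.sqrt (v * L) by rewrite sqrtrM ?(ltW vp)// mulrC.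
by rewrite ler_wsqrtr// ler_pM2l.
Qed.

Lemma epoch_exists (R : realType) (eta m v : R) : 1 < eta -> 0 < m -> m <= v ->
  exists k : nat, m * eta ^+ k <= v /\ v <= m * eta ^+ k.+1.
Proof.
move=> eta1 m0 mv; have lneta : 0 < ln eta by exact: ln_gt0.
have eta0 : 0 < eta by lra.
have vm : 1 <= v / m by rewrite ler_pdivlMr// mul1r.
have vm0 : 0 < v / m by lra.
have : 0 <= ln (v / m) / ln eta by rewrite divr_ge0 ?(ltW lneta) ?ln_ge0.
move=> /Num.Theory.truncn_itv/andP[h1 h2].
exists (Num.truncn (ln (v / m) / ln eta)).
rewrite ler_pdivlMr// mulr_natl -lnXn// in h1.
rewrite ltr_pdivrMr// mulr_natl -lnXn// in h2.
rewrite ler_ln ?posrE ?exprn_gt0// in h1.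
move/ltW : h2; rewrite ler_ln ?posrE ?exprn_gt0// => h2.
by rewrite !(mulrC m) -ler_pdivlMr// -[in X in _ /\ X]ler_pdivrMr.
Qed.

(** In epoch [k] one has [eta v / m >= eta^(k+1)], so the iterated logarithm is at least
    [ln (k + 1) + ln (ln eta)], whose last term cancels the factor [log^s eta] in [ell]. *)
Lemma ell_ge (R : realType) (d : nat) (m alpha eta s v : R) (k : nat) :
  (0 < d)%N -> 1 < eta -> 0 < m -> 0 < alpha -> 1 < s -> m * eta ^+ k <= v ->
  s * ln k.+1%:R + ln (d%:R * zeta s / alpha) <= ell d m alpha eta s v.
Proof.
move=> d0 eta1 m0 a0 s1 v1; rewrite /ell.
have eta0 : 0 < eta by lra.
have lneta : 0 < ln eta by exact: ln_gt0.
have z1 := zeta_ge1 s1; have z0 : 0 < zeta s by lra.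
have dz : 0 < d%:R * zeta s / alpha.
  by rewrite divr_gt0// mulr_gt0// ltr0n.
have -> : ln (d%:R * zeta s / (alpha * ln eta `^ s)) =
    ln (d%:R * zeta s / alpha) - s * ln (ln eta).
  rewrite invfM mulrA [LHS]ln_div ?posrE ?powR_gt0//.
  by rewrite ln_powR.
have h : k.+1%:R * ln eta <= ln (eta * v / m).
  rewrite mulr_natl -lnXn// ler_ln ?posrE ?exprn_gt0//.
    by rewrite exprS -mulrA ler_pM2l// ler_pdivlMr// mulrC.
  rewrite divr_gt0// mulr_gt0// (lt_le_trans _ v1)// mulr_gt0// exprn_gt0//.
have : ln k.+1%:R + ln (ln eta) <= ln (ln (eta * v / m)).
  have k0 : 0 < k.+1%:R * ln eta by rewrite mulr_gt0// ltr0n.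
  by rewrite -lnM ?posrE ?ltr0n// ler_ln ?posrE// (lt_le_trans k0).
by rewrite -(@ler_pM2l _ s)//; lra.
Qed.

Theorem corollary3 (R : realType) (disp : measure_display)
    (T : measurableType disp) (P : probability T R)
    (F : nat -> set (set T)) (hF : filtration F)
    (d : nat) (hd : (0 < d)%N)
    (b : R) (hb : 0 < b)
    (Y : nat -> T -> 'M[R]_d)
    (hYsym : forall t w, symmetric_mx (Y t w))
    (hYmart : martingale_mx P F Y)
    (hY0 : forall w, Y 0%N w = 0)
    (hYb : forall t, (1 <= t)%N ->
      {ae P, forall w, gamma_max (Y t w - Y t.-1 w) <= b})
    (* CE i is any symmetric-matrix-valued version of E_{i-1} (Y_i - Y_{i-1})^2 *)
    (CE : nat -> T -> 'M[R]_d)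
    (hCEsym : forall i w, (1 <= i)%N -> symmetric_mx (CE i w))
    (hCE : forall i, (1 <= i)%N ->
      is_condexp_mx P (F i.-1)
        (fun w => (Y i w - Y i.-1 w) *m (Y i w - Y i.-1 w)) (CE i))
    (eta s m alpha : R) (heta : 1 < eta) (hs : 1 < s) (hm : 0 < m)
    (halpha : 0 < alpha < 1) :
  let V (t : nat) (w : T) := gamma_max (\sum_(1 <= i < t.+1) CE i w) in
  let S (t : nat) (w : T) := gamma_max (Y t w) in
  let l := ell d m alpha eta s in
  let crossing : set T := [set w | exists2 t : nat, (1 <= t)%N &
       S t w >= k1 eta * Num.sqrt (Num.max (V t w) m * l (Num.max (V t w) m))
                + b * k2 eta / 3 * l (Num.max (V t w) m)] in
  (P crossing <= alpha%:E)%E.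
Proof.
pose V (t : nat) (w : T) := gamma_max (\sum_(1 <= i < t.+1) CE i w).
pose S (t : nat) (w : T) := gamma_max (Y t w).
pose l := ell d m alpha eta s.
pose crossing : set T := [set w | exists2 t : nat, (1 <= t)%N &
  S t w >= k1 eta * Num.sqrt (Num.max (V t w) m * l (Num.max (V t w) m))
           + b * k2 eta / 3 * l (Num.max (V t w) m)].
change (P crossing <= alpha%:E)%E; have /andP[a0 a1] := halpha.
have eta0 : 0 < eta by lra.
have z1 := zeta_ge1 hs; have z0 : 0 < zeta s by lra.
have d1 : 1 <= d%:R :> R by rewrite ler1n.
have dza : 1 < d%:R * zeta s / alpha.
  by rewrite ltr_pdivlMr// mul1r; nra.
(* Chosen so that [d exp (- L k) = alpha / (zeta s (k+1)^s)], the share of the error given to epoch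
   [k]. *)
pose L k := s * ln k.+1%:R + ln (d%:R * zeta s / alpha).
have L0 k : 0 < L k.
  rewrite ltr_wpDl// ?ln_gt0// mulr_ge0 ?ln_ge0//; last by rewrite ler1n.
  lra.
pose c := b / 3; have c0 : 0 < c by rewrite divr_gt0.
pose x k := Num.sqrt (2 * L k / (m * eta ^+ k * Num.sqrt eta)).
have x0 k : 0 < x k.
  by rewrite sqrtr_gt0 divr_gt0 ?mulr_gt0 ?exprn_gt0 ?sqrtr_gt0.
(* This choice gives [1 - lam b / 3 = 1 / (1 + c x)], hence [psi = lam x / 2]. Dividing line [k] by
   [lam] turns it into [S >= L / x + c L + x V / 2], the form bounded by [epoch_tangent]. *)
pose lam k := x k / (1 + c * x k).
have cx k : 0 < 1 + c * x k by rewrite addr_gt0// mulr_gt0.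
have lam0 k : 0 < lam k by rewrite divr_gt0.
have lam3 k : lam k * b < 3.
  rewrite /lam mulrAC ltr_pdivrMr//; have := x0 k; rewrite /c; nra.
have psiE k : lam k * x k / 2 = lam k ^+ 2 / (2 * (1 - lam k * b / 3)).
  have -> : 1 - lam k * b / 3 = (1 + c * x k)^-1.
    rewrite (_ : b = 3 * c); last by rewrite /c; field.
    by rewrite /lam; field; rewrite gt_eqF.
  by rewrite /lam; field; rewrite gt_eqF.
have [E hE] : exists E : nat -> set T, forall k, [/\ measurable (E k),
    forall t w, L k <= lam k * S t w - lam k * x k / 2 * V t w -> E k w &
    (P (E k) <= (d%:R * expR (- L k))%:E)%E].
  have H k : exists E : set T, [/\ measurable E,
    forall t w, L k <= lam k * S t w - lam k * x k / 2 * V t w -> E w &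
    (P E <= (d%:R * expR (- L k))%:E)%E].
    exact: (freedman_line (L k) hF hd hb hYsym hYmart hY0 hYb hCEsym hCE
      (lam0 k) (lam3 k) (psiE k)).
  by have /choice[E hE] := H; exists E.
(* At a crossing time the epoch containing [max (V, m)] determines which line has been crossed. *)
have sub : crossing `<=` \bigcup_k E k.
  move=> w [t t1]; set v := Num.max (V t w) m => St.
  have mv : m <= v by rewrite le_max lexx orbT.
  have [k [v1 v2]] := epoch_exists heta hm mv.
  exists k => //; have [_ + _] := hE k; apply.
  have Ll : L k <= l v by exact: ell_ge.
  have [_] := epoch_tangent heta hm (L0 k) Ll v1 v2; rewrite -/(x k) => tan.
  have k21 : 1 <= k2 eta.
    rewrite /k2 ler_pdivlMr// mul1r -lerBlDr.
    rewrite (_ : 2 - 1 = 1); last by ring.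
    by rewrite -[X in X <= _]sqrtr1 ler_sqrt// ltW.
  have h2 : c * L k <= b * k2 eta / 3 * l v.
    have -> : b * k2 eta / 3 = c * k2 eta by rewrite /c; ring.
    rewrite -mulrA ler_pM2l//; apply: (le_trans Ll).
    by rewrite ler_peMl// (le_trans (ltW (L0 k)) Ll).
  (* The epoch bound concerns [v = max (V, m)], whereas line [k] is drawn in [V] itself. *)
  have h3 : x k * V t w <= x k * v by rewrite ler_pM2l// le_max lexx.
  have h4 : L k / x k + x k * v / 2 + c * L k <= S t w.
    by apply: le_trans St; exact: lerD.
  have -> : L k = lam k * (L k / x k + c * L k).
    by rewrite /lam; field; rewrite !gt_eqF.
  rewrite (_ : _ - _ = lam k * (S t w - x k * V t w / 2)); last by ring.
  by rewrite ler_pM2l//; lra.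
have [sF FM FS] := hF; have [Ymeas _ _] := hYmart.
have mY t : measurable_mx (Y t).
  by move=> i j _ B mB; rewrite setTI; exact: FM (Ymeas t i j B mB).
have mCE i : (1 <= i)%N -> measurable_mx (CE i).
  move=> i1 j k _ B mB; rewrite setTI.
  by have [mC _ _] := hCE i i1 j k; exact: FM (mC B mB).
have mW t : measurable_mx (fun w => \sum_(1 <= i < t.+1) CE i w).
  under eq_fun do rewrite big_add1/= big_mkord.
  by apply: measurable_mx_sum => i; exact: mCE.
have mV t : measurable_fun [set: T] (V t).
  apply: measurable_gamma_max => // w.
  rewrite big_add1/= big_mkord linear_sum/=; apply: eq_bigr => i _.
  exact: hCEsym.
have mS t : measurable_fun [set: T] (S t).
  by apply: measurable_gamma_max => // w; exact: hYsym.
have mmax t : measurable_fun [set: T] (fun w => Num.max (V t w) m).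
  exact: measurable_maxr.
have ml t : measurable_fun [set: T] (fun w => l (Num.max (V t w) m)).
  apply: measurable_funD => //; apply: measurable_funM => //.
  apply: measurableT_comp => //; apply: measurableT_comp => //.
  by apply: measurable_funM => //; apply: measurable_funM.
(* Countable subadditivity below is applied to [crossing] as a measurable set. *)
have mcross : measurable crossing.
  rewrite (_ : crossing = \bigcup_(t in [set t | (1 <= t)%N])
     ((fun w => S t w - (k1 eta * Num.sqrt (Num.max (V t w) m *
        l (Num.max (V t w) m)) + b * k2 eta / 3 * l (Num.max (V t w) m)))
        @^-1` [set` `[0, +oo[])).
    apply: bigcup_measurable => t _; rewrite -[X in measurable X]setTI.
    apply: (_ : measurable_fun setT _) => //.
    apply: measurable_funB => //; apply: measurable_funD.
      apply: measurable_funM => //.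
      apply: (measurableT_comp (f := @Num.sqrt R)).
        by apply: continuous_measurable_fun; exact: sqrt_continuous.
      exact: measurable_funM.
    exact: measurable_funM.
  apply/seteqP; split => w /=.
    by move=> [t t1 h]; exists t => //=; rewrite in_itv/= andbT subr_ge0.
  by move=> [t /= t1]; rewrite in_itv/= andbT subr_ge0; exists t.
have mE k : measurable (E k) by case: (hE k).
apply: (@le_trans _ _ (\sum_(k <oo) P (E k))%E).
  exact: measure_sigma_subadditive.
(* The shares sum to exactly [alpha]; the term [riemannR s k] is [1 / (k+1)^s], which matches epochs
   numbered from [0]. *)
have -> : alpha%:E = (\sum_(0 <= k <oo) (alpha / zeta s * riemannR s k)%:E)%E.
  have E1 : (fun n => \sum_(0 <= k < n) (alpha / zeta s * riemannR s k)%:E)%E =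
      EFin \o (fun n => alpha / zeta s * series (riemannR s) n).
    by apply/funext => n /=; rewrite sumEFin -mulr_sumr.
  have cz : (fun n => alpha / zeta s * series (riemannR s) n) @ \oo -->
      alpha / zeta s * zeta s.
    by apply: cvgM; [exact: cvg_cst|exact: cvg_riemannR].
  rewrite E1 EFin_lim; last by apply/cvg_ex; exists (alpha / zeta s * zeta s).
  by rewrite (cvg_lim _ cz)// divfK// gt_eqF.
apply: lee_nneseries => [k _ _|k _]; first exact: measure_ge0.
have [_ _ /le_trans] := hE k; apply; rewrite lee_fin.
rewrite /L opprD expRD -ln_powR expRN lnK ?posrE ?powR_gt0 ?ltr0n//.
rewrite expRN lnK ?posrE; last lra.
rewrite /riemannR le_eqVlt; apply/orP; left; apply/eqP.
by field; rewrite !gt_eqF ?powR_gt0//; lra.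
Qed.
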